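(* Let $\mu$ be a partition of $m$, let $\nu$ be a partition of $n$, and set $\kappa=\nu'$ if $m$ is even and $\kappa=\nu$ if $m$ is odd. Let $\lambda$ be a partition of $mn$ that is minimal, in the dominance order, among the types of conjugate-semistandard tableau family tuples of shape $\mu^\kappa$ (equivalently, minimal such that the Specht module $S^\lambda$ is a summand of $H_\mu^\nu$). Let $\mathcal{T}^{(1)},\ldots,\mathcal{T}^{(d)}$ be conjugate-semistandard tableau family tuples of shape $\mu^\kappa$ and type $\lambda$. Suppose that for each $e\in\{1,\ldots,d\}$ there exists a conjugate-semistandard tableau $s^{(e)}\in\mathcal{T}^{(e)}$ such that if $c<e$ and $u\in\mathcal{T}^{(c)}$ then $\|u\|\prec_{\mathrm{col}}\|s^{(e)}\|$. (i) If $m$ is even then the homomorphisms $\overline{f}_{\mathcal{T}^{(1)}},\ldots,\overline{f}_{\mathcal{T}^{(d)}}: S^\lambda\to H_\mu^\nu$ are linearly independent. (ii) If $m$ is odd then the homomorphisms $\overline{g}_{\mathcal{T}^{(1)}},\ldots,\overline{g}_{\mathcal{T}^{(d)}}: S^\lambda\to H_\mu^\nu$ are linearly independent.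
   Context: Tableau conventions. Maps are written on the right. $[\gamma]=\{(i,j): 1\le j\le\gamma_i\}$. A $\gamma$-tableau with entries from $X$ is a function $t:[\gamma]\to X$, $(i,j)\mapsto (i,j)t$; $\gamma'$ is the conjugate partition and $t'$ the conjugate tableau. For $\sigma\in S_{[\gamma]}$, $t\cdot\sigma$ is defined by $(i,j)(t\cdot\sigma)=((i,j)\sigma^{-1})t$. $\mathrm{RPP}(\gamma)$ and $\mathrm{CPP}(\gamma)$ are the subgroups of $S_{[\gamma]}$ preserving every row, respectively every column. $\{t\}$ is the class of $t$ up to $\mathrm{RPP}(\gamma)$ (the tabloid) and $\|t\|$ (the columnar tabloid) is the class of $t$ up to $\mathrm{CPP}(\gamma)$. For tableaux with distinct entries, $|t|$ denotes formal symbols subject to $|t\cdot\tau|=\mathrm{sgn}(\tau)|t|$ for $\tau\in\mathrm{CPP}(\gamma)$. Order. For tableaux $u,v$ of shape $\mu$ with entries in $\mathbb{N}$, $\|u\|\preceq_{\mathrm{col}}\|v\|$ if either the multisets of entries of $u,v$ agree in every column, or, in the rightmost column where these multisets differ, the entries can be ordered so that $u$ has entries $\alpha_1,\ldots,\alpha_p$ and $v$ has entries $\beta_1,\ldots,\beta_p$ with $\alpha_i\le\beta_i$ for all $i$. $\|u\|\prec_{\mathrm{col}}\|v\|$ means $\|u\|\preceq_{\mathrm{col}}\|v\|$ and not $\|v\|\preceq_{\mathrm{col}}\|u\|$. Families. A tableau with entries in $\mathbb{N}=\{1,2,\ldots\}$ is conjugate-semistandard if its rows are strictly increasing and its columns weakly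 increasing. For $\kappa$ a partition of $n$ with exactly $c$ parts, a conjugate-semistandard tableau family tuple of shape $\mu^\kappa$ is a tuple $\mathcal{T}=(\mathcal{T}_1,\ldots,\mathcal{T}_c)$ where $\mathcal{T}_i$ is a set of $\kappa_i$ distinct conjugate-semistandard $\mu$-tableaux; $t\in\mathcal{T}$ means $t\in\mathcal{T}_i$ for some $i$. It has type $\lambda$ if, for every $j$, the total number of entries equal to $j$ in all tableaux of all $\mathcal{T}_i$ is $\lambda'_j$. Symbols and Specht modules. $\Omega^\lambda$ is the set of formal symbols $y_x$ for $(x,y)\in[\lambda]$ ($y$ is the number, $x$ the index). $I(\lambda)\le S_{\Omega^\lambda}$ is the Young subgroup with orbits $\{y_x:1\le x\le\lambda'_y\}$, for $1\le y\le\lambda_1$. $t_\lambda$ is the $\lambda$-tableau with $(x,y)t_\lambda=y_x$. $\widetilde{M}^\lambda$ is the $\mathbb{Q}S_{\Omega^\lambda}$-module spanned by the $|t|$ for $t$ a $\lambda$-tableau with distinct entries from $\Omega^\lambda$ (subject only to $|t\cdot\tau|=\mathrm{sgn}(\tau)|t|$ for $\tau\in\mathrm{CPP}(\lambda)$), with action $|t|\phi=|t\phi|$; it is generated by $|t_\lambda|$. The Specht module $S^\lambda$ is spanned by the polytabloids $e(t)=\sum_{\tau\in\mathrm{CPP}(\lambda)}\{t\cdot\tau\}\,\mathrm{sgn}(\tau)$, and the canonical surjection $\widetilde{M}^\lambda\to S^\lambda$ is $|t|\mapsto e(t)$. Generalized Foulkes module. For a $\mathbb{Q}S_m$-module $W$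 and a $\mathbb{Q}S_n$-module $Z$, $W\oslash Z$ is the $\mathbb{Q}(S_m\wr S_n)$-module $W^{\otimes n}\otimes Z$ in which $S_m^n$ acts factorwise on $W^{\otimes n}$ and trivially on $Z$, and $S_n$ permutes the factors of $W^{\otimes n}$ and acts on $Z$ in the given way. $H_\mu^\nu=(S^\mu\oslash S^\nu)\uparrow_{S_m\wr S_n}^{S_{mn}}$, where $S_m\wr S_n\le S_{mn}$ is the transitive imprimitive subgroup and $S_{mn}$ is identified with $S_{\Omega^\lambda}$. Models. $\mathcal{N}$ is the set of $\nu$-tableaux $\mathbf{T}$ whose entries are $\mu$-tableaux with distinct entries from $\Omega^\lambda$, such that the union of the entry sets of these $n$ $\mu$-tableaux is $\Omega^\lambda$. $S_{\Omega^\lambda}$ acts on $\mathcal{N}$ by acting on every entry of every $\mu$-tableau. For $\sigma=(\sigma_{(i,j)})_{(i,j)\in[\nu]}$ in $\mathrm{RPP}(\mu)^n$ or $\mathrm{CPP}(\mu)^n$, $\mathbf{T}\star\sigma$ is defined by $(i,j)(\mathbf{T}\star\sigma)=((i,j)\mathbf{T})\cdot\sigma_{(i,j)}$, and $\mathrm{sgn}(\sigma)=\prod\mathrm{sgn}(\sigma_{(i,j)})$. $N$ is the $\mathbb{Q}$-span of the tabloids $\{\mathbf{T}\}$, and $\widetilde{N}$ the $\mathbb{Q}$-span of the $|\mathbf{T}|$, $\mathbf{T}\in\mathcal{N}$ (subject to $|\mathbf{T}\cdot\tau|=\mathrm{sgn}(\tau)|\mathbf{T}|$, $\tau\in\mathrm{CPP}(\nu)$).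 $C\le N$ is the span of all $\{\mathbf{T}\star\pi\}-\mathrm{sgn}(\pi)\{\mathbf{T}\}$, and $\widetilde{C}\le\widetilde{N}$ the span of all $|\mathbf{T}\star\pi|-\mathrm{sgn}(\pi)|\mathbf{T}|$, for $\mathbf{T}\in\mathcal{N}$, $\pi\in\mathrm{CPP}(\mu)^n$. The tableau $\mathbf{T}_{\mathcal{T}}$. Totally order conjugate-semistandard $\mu$-tableaux by $u<v$ if, in the rightmost column in which they differ, with entries $\alpha_1\le\dots\le\alpha_p$ for $u$ and $\beta_1\le\dots\le\beta_p$ for $v$, for some $q$ we have $\alpha_q<\beta_q$ and $\alpha_i=\beta_i$ for $i>q$. Let $S$ be the $\kappa$-tableau whose $(i,j)$ entry is the $j$th smallest element of $\mathcal{T}_i$. Let $\mathbf{S}$ be obtained from $S$ by replacing the occurrences of each number $y$ by $y_1,y_2,\ldots$ in turn, going through the boxes of $[\kappa]$ in lexicographic order and, within each $\mu$-tableau, through the boxes of $[\mu]$ in lexicographic order. Put $\mathbf{T}_{\mathcal{T}}=\mathbf{S}'$ if $m$ is even and $\mathbf{T}_{\mathcal{T}}=\mathbf{S}$ if $m$ is odd; this is an element of $\mathcal{N}$. Homomorphisms. There are well-defined $\mathbb{Q}S_{\Omega^\lambda}$-homomorphisms $\overline{f}_{\mathcal{T}}:\widetilde{M}^\lambda\to N/C$ and $\overline{g}_{\mathcal{T}}:\widetilde{M}^\lambda\to\widetilde{N}/\widetilde{C}$ with $$|t_\lambda|\overline{f}_{\mathcal{T}}=\sum_{\theta\in I(\lambda)}\sum_{\tau\in\mathrm{CPP}(\nu)}\sum_{\sigma\in\mathrm{RPP}(\mu)^n}\{(\mathbf{T}_{\mathcal{T}}\theta\cdot\tau)\star\sigma\}\,\mathrm{sgn}(\theta)\,\mathrm{sgn}(\tau)+C,$$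 $$|t_\lambda|\overline{g}_{\mathcal{T}}=\sum_{\theta\in I(\lambda)}\sum_{\tau\in\mathrm{RPP}(\nu)}\sum_{\sigma\in\mathrm{RPP}(\mu)^n}|(\mathbf{T}_{\mathcal{T}}\theta\cdot\tau)\star\sigma|\,\mathrm{sgn}(\theta)+\widetilde{C}.$$ Their images lie in submodules of $N/C$ and $\widetilde{N}/\widetilde{C}$, respectively, that are isomorphic to $H_\mu^\nu$ and are identified with it. Since $\lambda$ is a minimal type, these maps factor through the canonical surjection $\widetilde{M}^\lambda\to S^\lambda$, $|t|\mapsto e(t)$; the induced homomorphisms $S^\lambda\to H_\mu^\nu$ are denoted by the same symbols $\overline{f}_{\mathcal{T}}$, $\overline{g}_{\mathcal{T}}$. *)

(* Defs.v *)
(* MathComp, with finmap for finite sets of tableaux with entries in nat *)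
From HB Require Import structures.
From mathcomp Require Import all_boot all_order all_fingroup all_algebra finmap.

Set Implicit Arguments.
Unset Strict Implicit.
Unset Printing Implicit Defensive.

Import GRing.Theory.
Local Open Scope ring_scope.

(* Parts are listed in decreasing order, and all of them are positive. *)
Definition is_partition (n : nat) (p : seq nat) : bool :=
  [&& sorted geq p, 0%N \notin p & sumn p == n].

Definition conj_part (p : seq nat) : seq nat :=
  mkseq (fun j => count (fun r => (j < r)%N) p) (head 0%N p).

Definition dominated (a b : seq nat) : Prop :=
  forall k, (sumn (take k a) <= sumn (take k b))%N.

(* Rows and columns of boxes are numbered from 0. *)
Definition box (g : seq nat) := {i : 'I_(size g) & 'I_(nth 0%N g i)}.

Definition row_of (g : seq nat) (b : box g) : nat := tag b.
Definition col_of (g : seq nat) (b : box g) : nat := tagged b.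
Definition box_pos (g : seq nat) (b : box g) : nat * nat := (row_of b, col_of b).

Definition lexlt (p q : nat * nat) : bool :=
  (p.1 < q.1)%N || (p.1 == q.1) && (p.2 < q.2)%N.

Notation tableau g X := {ffun box g -> X}.

Definition RPP (g : seq nat) : {set {perm box g}} :=
  [set s : {perm box g} | [forall b, row_of (s b) == row_of b]].
Definition CPP (g : seq nat) : {set {perm box g}} :=
  [set s : {perm box g} | [forall b, col_of (s b) == col_of b]].

Definition sgn (T : finType) (s : {perm T}) : rat := (-1) ^+ odd_perm s.

(* The place permutation t . s *)
Definition tmove (g : seq nat) (X : Type) (t : tableau g X) (s : {perm box g}) :
  tableau g X := [ffun b => t ((s^-1)%g b)].

Definition relabel (g : seq nat) (X Y : Type) (f : X -> Y) (t : tableau g X) :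
  tableau g Y := [ffun b => f (t b)].

(* T * s, where s gives one place permutation for each box of g *)
Definition star (g mu : seq nat) (X : Type) (T : tableau g (tableau mu X))
    (s : {ffun box g -> {perm box mu}}) : tableau g (tableau mu X) :=
  [ffun b => tmove (T b) (s b)].

Definition sgn_family (g mu : seq nat) (s : {ffun box g -> {perm box mu}}) : rat :=
  \prod_b sgn (s b).

Definition tabloid (g : seq nat) (X : finType) (t : tableau g X) :
  {set tableau g X} := [set tmove t s | s in RPP g].

Definition conj_semistandard (mu : seq nat) (t : tableau mu nat) : Prop :=
  [/\ forall b, (0 < t b)%N,
      forall b b', row_of b = row_of b' -> (col_of b < col_of b')%N -> (t b < t b')%N
    & forall b b', col_of b = col_of b' -> (row_of b < row_of b')%N -> (t b <= t b')%N].

Definition family_tuple (mu kappa : seq nat) :=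
  (size kappa).-tuple {fset tableau mu nat}.

Definition is_family_tuple (mu kappa : seq nat) (T : family_tuple mu kappa) :
  Prop := forall i : 'I_(size kappa),
    #|` tnth T i| = nth 0%N kappa i /\
    (forall t, t \in tnth T i -> conj_semistandard t).

Definition in_family (mu kappa : seq nat) (t : tableau mu nat)
    (T : family_tuple mu kappa) : Prop :=
  exists i : 'I_(size kappa), t \in tnth T i.

Definition has_type (mu kappa la : seq nat) (T : family_tuple mu kappa) : Prop :=
  forall j : nat,
    (\sum_(i < size kappa) \sum_(t <- tnth T i) #|[set b | t b == j.+1]|)%N
    = nth 0%N (conj_part la) j.

Definition is_type (mu kappa la : seq nat) : Prop :=
  exists T : family_tuple mu kappa, is_family_tuple T /\ has_type la T.

Definition minimal_type (N : nat) (mu kappa la : seq nat) : Prop :=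
  [/\ is_partition N la, is_type mu kappa la
    & forall a, is_partition N a -> is_type mu kappa a -> dominated a la ->
      a = la].

Definition col_entries (mu : seq nat) (t : tableau mu nat) (j : nat) : seq nat :=
  [seq t b | b <- enum {: box mu} & col_of b == j].

Definition col_le (mu : seq nat) (u v : tableau mu nat) : Prop :=
  (forall j, perm_eq (col_entries u j) (col_entries v j)) \/
  exists j : nat,
    [/\ ~~ perm_eq (col_entries u j) (col_entries v j),
        forall k, (j < k)%N -> perm_eq (col_entries u k) (col_entries v k)
      & exists a b : seq nat,
          [/\ perm_eq a (col_entries u j), perm_eq b (col_entries v j)
            & all2 leq a b]].

Definition col_lt (mu : seq nat) (u v : tableau mu nat) : Prop :=
  col_le u v /\ ~ col_le v u.

Definition csst_lt (mu : seq nat) (u v : tableau mu nat) : bool :=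
  let c (t : tableau mu nat) (j : nat) := sort leq (col_entries t j) in
  [exists j : 'I_(head 0%N mu),
    [&& c u j != c v j,
        [forall k : 'I_(head 0%N mu), (j < k)%N ==> (c u k == c v k)]
      & [exists q : 'I_(size mu),
          (nth 0%N (c u j) q < nth 0%N (c v j) q)%N &&
          [forall i : 'I_(size mu),
            (q < i)%N ==> (nth 0%N (c u j) i == nth 0%N (c v j) i)%N]]]].

Definition csst_le (mu : seq nat) (u v : tableau mu nat) : bool :=
  (u == v) || csst_lt u v.

(* The symbol y_x, for (x, y) in [la], is the box in row x - 1 and column y - 1:
   the number is the column and the index is the row. *)
Definition Omega (la : seq nat) := box la.

Definition symbol_number (la : seq nat) (w : Omega la) : nat := (col_of w).+1.
Definition symbol_index (la : seq nat) (w : Omega la) : nat := (row_of w).+1.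

Definition t_la (la : seq nat) : tableau la (Omega la) := [ffun b => b].

Definition Isym (la : seq nat) : {set {perm Omega la}} :=
  [set s : {perm Omega la} | [forall w, symbol_number (s w) == symbol_number w]].

Definition kappa (m : nat) (nu : seq nat) : seq nat :=
  if odd m then nu else conj_part nu.

Definition family_tableau (mu ka : seq nat) (T : family_tuple mu ka) :
  tableau ka (tableau mu nat) :=
  [ffun b => nth [ffun=> 0%N] (sort (@csst_le mu) (tnth T (tag b))) (col_of b)].

(* SS is obtained from S by replacing the occurrences of each number y by
   y_1, y_2, ... in turn. *)
Definition numbering (mu ka la : seq nat) (S : tableau ka (tableau mu nat))
    (SS : tableau ka (tableau mu (Omega la))) : Prop :=
  forall p q,
    symbol_number (SS p q) = S p q /\
    symbol_index (SS p q) =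
      #|[set r : box ka * box mu |
          (S r.1 r.2 == S p q) &&
          (lexlt (box_pos r.1) (box_pos p) || (r.1 == p) && lexlt (box_pos r.2) (box_pos q))]|.+1.

(* TT is SS' if m is even, and SS if m is odd, where SS numbers the tableau of T. *)
Definition is_T_of_family (m : nat) (mu nu la : seq nat)
    (T : family_tuple mu (kappa m nu))
    (TT : tableau nu (tableau mu (Omega la))) : Prop :=
  exists SS : tableau (kappa m nu) (tableau mu (Omega la)),
    numbering (family_tableau T) SS /\
    forall (p : box nu) (p' : box (kappa m nu)),
      box_pos p' = (if odd m then (row_of p, col_of p) else (col_of p, row_of p)) ->
      TT p = SS p'.

Notation freeQ X := {ffun X -> rat^o}.

Definition dirac (X : finType) (x : X) : freeQ X := [ffun y => (y == x)%:R].

Definition push (X Y : finType) (f : X -> Y) (v : freeQ X) : freeQ Y :=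
  \sum_x (v x : rat) *: dirac (f x).

Lemma push_is_linear (X Y : finType) (f : X -> Y) : linear (push f).
Proof.
move=> a u v; rewrite /push scaler_sumr -big_split /=.
by apply: eq_bigr => x _; rewrite !ffunE scalerDl scalerA.
Qed.

HB.instance Definition _ (X Y : finType) (f : X -> Y) :=
  GRing.isLinear.Build rat (freeQ X) (freeQ Y) _ (push f) (push_is_linear f).

Lemma push_dirac (X Y : finType) (f : X -> Y) (x : X) :
  push f (dirac x) = dirac (f x).
Proof.
rewrite /push (bigD1 x) //= big1 => [|y /negPf yx]; rewrite ffunE ?yx ?scale0r //.
by rewrite eqxx scale1r addr0.
Qed.

Lemma push_diracB (X Y : finType) (f : X -> Y) (c : rat) (x y : X) (x' y' : Y) :
  f x = x' -> f y = y' ->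
  push f (dirac x - c *: dirac y) = dirac x' - c *: dirac y'.
Proof. by move=> <- <-; rewrite linearB linearZ /= !push_dirac. Qed.

Lemma push_comp (X Y Z : finType) (f : Y -> Z) (g : X -> Y) (v : freeQ X) :
  push f (push g v) = push (f \o g) v.
Proof.
by rewrite {2}/push linear_sum /=; apply: eq_bigr => x _; rewrite linearZ /= push_dirac.
Qed.

Lemma eq_push (X Y : finType) (f g : X -> Y) : f =1 g -> push f =1 push g.
Proof. by move=> fg v; apply: eq_bigr => x _; rewrite fg. Qed.

Lemma push_inj (X Y : finType) (f : X -> Y) (v : freeQ X) (x : X) :
  injective f -> push f v (f x) = v x.
Proof.
move=> finj; rewrite /push sum_ffunE (bigD1 x) //= big1 => [|z zx].
  by rewrite !ffunE eqxx addr0 /GRing.scale /= mulr1.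
by rewrite !ffunE (inj_eq finj) eq_sym (negPf zx) scaler0.
Qed.

Lemma memv_sum_line_map (V V' : vectType rat) (L : {linear V -> V'})
    (I : finType) (P : pred I) (U : I -> {vspace V}) (W : {vspace V'}) (x : V) :
    (forall i y, P i -> y \in U i -> L y \in W) ->
  x \in (\sum_(i | P i) U i)%VS -> L x \in W.
Proof.
move=> LW /memv_sumP[y yU ->]; rewrite linear_sum memv_suml //= => i Pi.
exact: LW (yU i Pi).
Qed.

Lemma memv_line_map (V V' : vectType rat) (L : {linear V -> V'}) (v : V)
    (w : V') (W : {vspace V'}) (x : V) :
  L v = w -> w \in W -> x \in <[v]>%VS -> L x \in W.
Proof. by move=> Lv wW /vlineP[k ->]; rewrite linearZ Lv memvZ. Qed.

(* A right QG-module, presented as the quotient gm_sub / gm_rel of two submodules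
   of the permutation module on a G-set. *)
Record gmodule (gT : finGroupType) := GModule {
  gm_base : finType;
  gm_act : {action gT &-> gm_base};
  gm_sub : {vspace freeQ gm_base};
  gm_rel : {vspace freeQ gm_base};
  gm_rel_sub : (gm_rel <= gm_sub)%VS;
  gm_sub_stable : forall a v, v \in gm_sub -> push (gm_act^~ a) v \in gm_sub;
  gm_rel_stable : forall a v, v \in gm_rel -> push (gm_act^~ a) v \in gm_rel }.

(* The quotient is realized as the complement of gm_rel in gm_sub, and the coset
   of v is the projection of v along gm_rel. *)
Definition carrier (gT : finGroupType) (M : gmodule gT) :=
  subvs_of (gm_sub M :\: gm_rel M)%VS.

Definition coset_mod (gT : finGroupType) (M : gmodule gT)
    (v : freeQ (gm_base M)) : carrier M :=
  vsproj (gm_sub M :\: gm_rel M)%VS (addv_pi1 (gm_sub M) (gm_rel M) v).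

Lemma coset_mod_onto (gT : finGroupType) (M : gmodule gT) (x : carrier M) :
  exists2 v, v \in gm_sub M & coset_mod v = x.
Proof.
have xU := subvsP x; have xS : vsval x \in gm_sub M.
  by apply: subvP xU; exact: diffvSl.
exists (vsval x) => //; apply: val_inj; rewrite /= /coset_mod.
have e : addv_pi1 (gm_sub M) (gm_rel M) (vsval x) = vsval x.
  exact: daddv_pi_id (capv_diff _ _) xU.
by rewrite e vsprojK.
Qed.

Lemma coset_mod_eq0 (gT : finGroupType) (M : gmodule gT) (v : freeQ (gm_base M)) :
  v \in gm_sub M -> (coset_mod v == 0) = (v \in gm_rel M).
Proof.
move=> vS; have dV := capv_diff (gm_sub M) (gm_rel M).
have pU : addv_pi1 (gm_sub M) (gm_rel M) v \in (gm_sub M :\: gm_rel M)%VS.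
  exact: memv_pi.
have vSR : v \in (gm_sub M + gm_rel M)%VS by apply: subvP vS; exact: addvSl.
have e := addv_pi1_pi2 vSR.
apply/eqP/idP => [/(congr1 vsval) | vR].
  rewrite /coset_mod vsprojK // => v0; rewrite -e v0 add0r; exact: memv_pi2.
apply: val_inj; rewrite /= /coset_mod vsprojK //.
apply/eqP; rewrite -memv0 -dV memv_cap pU /=.
have -> : addv_pi1 (gm_sub M) (gm_rel M) v =
  v - addv_pi2 (gm_sub M) (gm_rel M) v by rewrite -{2}e addrK.
by rewrite memvB // memv_pi2.
Qed.

Definition gact (gT : finGroupType) (M : gmodule gT) (a : gT) (x : carrier M) :
  carrier M := coset_mod (push ((gm_act M)^~ a) (vsval x)).

Definition is_hom (gT : finGroupType) (M M' : gmodule gT)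
    (f : 'Hom(carrier M, carrier M')) : Prop :=
  forall a x, f (gact a x) = gact a (f x).

Section TableauAction.
Variables (gT : finGroupType) (X : finType) (to : {action gT &-> X}) (g : seq nat).

Definition tabact (t : tableau g X) (a : gT) : tableau g X := relabel (to^~ a) t.

Lemma tabact1 : tabact^~ 1%g =1 id.
Proof. by move=> t; apply/ffunP=> b; rewrite ffunE act1. Qed.

Lemma tabactM : forall t, act_morph tabact t.
Proof. by move=> t a c; apply/ffunP=> b; rewrite !ffunE actM. Qed.

Canonical tab_action := TotalAction tabact1 tabactM.

Lemma tabact_move t s a : tabact (tmove t s) a = tmove (tabact t a) s.
Proof. by apply/ffunP=> b; rewrite !ffunE. Qed.

Lemma tabloid_act t a : (tab_action^*)%act (tabloid t) a = tabloid (tabact t a).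
Proof.
rewrite /= /setact /tabloid -imset_comp; apply: eq_imset => s /=.
exact: tabact_move.
Qed.

Lemma injective_tabact (t : tableau g X) a : injectiveb t -> injectiveb (tabact t a).
Proof.
move/injectiveP=> tinj; apply/injectiveP=> b c; rewrite !ffunE => e.
exact/tinj/(act_inj to a).
Qed.

End TableauAction.
Arguments tab_action {gT X} to g.

Definition polytabloid (g : seq nat) (X : finType) (t : tableau g X) :
  freeQ {set tableau g X} :=
  \sum_(s in CPP g) sgn s *: dirac (tabloid (tmove t s)).

Section Specht.
Variables (g : seq nat) (X : finType).

Definition specht_space : {vspace freeQ {set tableau g X}} :=
  (\sum_(t : tableau g X | injectiveb t) <[polytabloid t]>)%VS.

Definition specht_action := ((tab_action ('P%act : {action {perm X} &-> X}) g)^*)%act.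

Lemma polytabloid_act t a :
  push (specht_action^~ a) (polytabloid t) = polytabloid (tab_action 'P g t a).
Proof.
rewrite /polytabloid linear_sum; apply: eq_bigr => s _ /=.
by rewrite linearZ /= push_dirac tabloid_act tabact_move.
Qed.

Lemma specht_stable a v :
  v \in specht_space -> push (specht_action^~ a) v \in specht_space.
Proof.
apply: memv_sum_line_map => t y tinj.
apply: memv_line_map (polytabloid_act t a) _; rewrite memvE.
by rewrite (sumv_sup (tab_action 'P g t a)) // injective_tabact.
Qed.

Lemma zero_stable a (v : freeQ {set tableau g X}) :
  v \in 0%VS -> push (specht_action^~ a) v \in 0%VS.
Proof. by rewrite !memv0 => /eqP->; rewrite linear0. Qed.

(* The Specht module of Sym(X), for X a set with as many elements as [g] *)
Definition specht : gmodule {perm X} :=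
  GModule (sub0v specht_space) specht_stable zero_stable.

(* The module spanned by the symbols |t|, with |t . s| = sgn(s) |t| *)
Definition M_tilde_space : {vspace freeQ (tableau g X)} :=
  (\sum_(t : tableau g X | injectiveb t) <[dirac t]>)%VS.

Definition M_tilde_rel : {vspace freeQ (tableau g X)} :=
  (\sum_(t : tableau g X | injectiveb t) \sum_(s in CPP g)
     <[dirac (tmove t s) - sgn s *: dirac t]>)%VS.

Lemma injective_move (t : tableau g X) s : injectiveb t -> injectiveb (tmove t s).
Proof.
by move/injectiveP=> tinj; apply/injectiveP=> b c; rewrite !ffunE => /tinj/perm_inj.
Qed.

Lemma mem_M_tilde (t : tableau g X) : injectiveb t -> dirac t \in M_tilde_space.
Proof. by move=> ti; rewrite memvE (sumv_sup t). Qed.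

Lemma M_tilde_rel_sub : (M_tilde_rel <= M_tilde_space)%VS.
Proof.
apply/subv_sumP=> t tinj; apply/subv_sumP=> s _; rewrite -memvE.
by rewrite memvB ?memvZ ?mem_M_tilde // injective_move.
Qed.

Lemma M_tilde_stable a v : v \in M_tilde_space ->
  push ((tab_action ('P%act : {action {perm X} &-> X}) g)^~ a) v \in M_tilde_space.
Proof.
apply: memv_sum_line_map => t y tinj.
by apply: memv_line_map (push_dirac _ _) _; rewrite mem_M_tilde ?injective_tabact.
Qed.

Lemma M_tilde_rel_stable a v : v \in M_tilde_rel ->
  push ((tab_action ('P%act : {action {perm X} &-> X}) g)^~ a) v \in M_tilde_rel.
Proof.
apply: memv_sum_line_map => t y tinj; apply: memv_sum_line_map => s z sC.
have e := tabact_move 'P%act t s a.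
apply: memv_line_map (push_diracB (f := (tab_action 'P g)^~ a) _ e erefl) _.
by rewrite memvE (sumv_sup (tab_action 'P g t a)) ?injective_tabact // (sumv_sup s).
Qed.

Definition M_tilde : gmodule {perm X} :=
  GModule M_tilde_rel_sub M_tilde_stable M_tilde_rel_stable.

End Specht.

Section Models.
Variables (mu nu la : seq nat).

Local Notation tt := (tableau nu (tableau mu (Omega la))).

Definition calN : {set tt} :=
  [set T : tt | [forall p, injectiveb (T p)] &&
                [forall w, [exists p, [exists q, T p q == w]]]].

Definition tt_action : {action {perm Omega la} &-> tt} :=
  tab_action (tab_action 'P%act mu) nu.

Lemma calN_act T a : T \in calN -> tt_action T a \in calN.
Proof.
rewrite !inE => /andP[/forallP Ti /forallP Ts]; apply/andP; split.
  by apply/forallP=> p; rewrite ffunE injective_tabact.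
apply/forallP=> w; have /existsP[p /existsP[q /eqP e]] := Ts ((a^-1)%g w).
apply/existsP; exists p; apply/existsP; exists q.
by rewrite !ffunE /= apermE e permKV.
Qed.

Lemma calN_move T s : T \in calN -> tmove T s \in calN.
Proof.
rewrite !inE => /andP[/forallP Ti /forallP Ts]; apply/andP; split.
  by apply/forallP=> p; rewrite ffunE.
apply/forallP=> w; have /existsP[p /existsP[q /eqP e]] := Ts w.
by apply/existsP; exists (s p); apply/existsP; exists q; rewrite ffunE permK e.
Qed.

Lemma calN_star T s : T \in calN -> star T s \in calN.
Proof.
rewrite !inE => /andP[/forallP Ti /forallP Ts]; apply/andP; split.
  by apply/forallP=> p; rewrite ffunE injective_move.
apply/forallP=> w; have /existsP[p /existsP[q /eqP e]] := Ts w.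
by apply/existsP; exists p; apply/existsP; exists (s p q); rewrite !ffunE permK e.
Qed.

Lemma tt_act_star T s a : tt_action (star T s) a = star (tt_action T a) s.
Proof. by apply/ffunP=> p; apply/ffunP=> q; rewrite !ffunE. Qed.

Definition N_space : {vspace freeQ {set tt}} :=
  (\sum_(T in calN) <[dirac (tabloid T)]>)%VS.

Definition C_space : {vspace freeQ {set tt}} :=
  (\sum_(T in calN) \sum_(s in ffun_on (mem (CPP mu)))
     <[dirac (tabloid (star T s)) - sgn_family s *: dirac (tabloid T)]>)%VS.

Lemma mem_N T : T \in calN -> dirac (tabloid T) \in N_space.
Proof. by move=> TN; rewrite memvE (sumv_sup T). Qed.

Lemma C_sub_N : (C_space <= N_space)%VS.
Proof.
apply/subv_sumP=> T TN; apply/subv_sumP=> s _; rewrite -memvE.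
by rewrite memvB ?memvZ ?mem_N // calN_star.
Qed.

Lemma N_stable a v :
  v \in N_space -> push ((tt_action^*)%act^~ a) v \in N_space.
Proof.
apply: memv_sum_line_map => T y TN.
apply: memv_line_map (push_dirac _ _) _.
by have /= -> := tabloid_act (tab_action 'P mu) T a; rewrite mem_N // calN_act.
Qed.

Lemma C_stable a v :
  v \in C_space -> push ((tt_action^*)%act^~ a) v \in C_space.
Proof.
apply: memv_sum_line_map => T y TN; apply: memv_sum_line_map => s z sC.
have e := tabloid_act (tab_action 'P%act mu) (star T s) a.
rewrite [tabact _ _ _]tt_act_star in e.
apply: memv_line_map (push_diracB (f := (tt_action^*)%act^~ a) _ e (tabloid_act _ T a)) _.
by rewrite memvE (sumv_sup (tt_action T a)) ?calN_act // (sumv_sup s).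
Qed.

Definition N_mod_C : gmodule {perm Omega la} :=
  GModule C_sub_N N_stable C_stable.

Definition Nt_space : {vspace freeQ tt} :=
  (\sum_(T in calN) <[dirac T]>)%VS.

(* The first summand imposes |T . s| = sgn(s) |T|, the second one is C~ *)
Definition Ct_space : {vspace freeQ tt} :=
  (\sum_(T in calN) \sum_(s in CPP nu) <[dirac (tmove T s) - sgn s *: dirac T]> +
   \sum_(T in calN) \sum_(s in ffun_on (mem (CPP mu)))
     <[dirac (star T s) - sgn_family s *: dirac T]>)%VS.

Lemma mem_Nt T : T \in calN -> dirac T \in Nt_space.
Proof. by move=> TN; rewrite memvE (sumv_sup T). Qed.

Lemma Ct_sub_Nt : (Ct_space <= Nt_space)%VS.
Proof.
rewrite subv_add; apply/andP; split; apply/subv_sumP=> T TN.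
  apply/subv_sumP=> s _; rewrite -memvE.
  by rewrite memvB ?memvZ ?mem_Nt // calN_move.
apply/subv_sumP=> s _; rewrite -memvE.
by rewrite memvB ?memvZ ?mem_Nt // calN_star.
Qed.

Lemma Nt_stable a v : v \in Nt_space -> push (tt_action^~ a) v \in Nt_space.
Proof.
apply: memv_sum_line_map => T y TN.
by apply: memv_line_map (push_dirac _ _) _; rewrite mem_Nt ?calN_act.
Qed.

Lemma Ct_stable a v : v \in Ct_space -> push (tt_action^~ a) v \in Ct_space.
Proof.
case/memv_addP=> v1 v1C [v2 v2C ->]; rewrite linearD memv_add //.
  apply: memv_sum_line_map v1C => T y TN; apply: memv_sum_line_map => s z sC.
  have e := tabact_move (tab_action 'P%act mu) T s a.
  apply: memv_line_map (push_diracB (f := tt_action^~ a) _ e erefl) _.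
  by rewrite memvE (sumv_sup (tt_action T a)) ?calN_act // (sumv_sup s).
apply: memv_sum_line_map v2C => T y TN; apply: memv_sum_line_map => s z sC.
have e := tt_act_star T s a.
apply: memv_line_map (push_diracB (f := tt_action^~ a) _ e erefl) _.
by rewrite memvE (sumv_sup (tt_action T a)) ?calN_act // (sumv_sup s).
Qed.

Definition Nt_mod_Ct : gmodule {perm Omega la} :=
  GModule Ct_sub_Nt Nt_stable Ct_stable.

End Models.

Section Foulkes.
Variables (m n : nat) (mu nu : seq nat) (Om : finType).

(* The identification of S_mn with Sym(Om) *)
Variable beta : 'I_n * 'I_m -> Om.

(* S^mu (/) S^nu is spanned by the pure tensors
   e(t_1) (x) ... (x) e(t_n) (x) e(u), inside the permutation module on
   pairs (n-tuple of mu-tabloids, nu-tabloid). *)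
Definition oslash_base :=
  ({ffun 'I_n -> {set tableau mu 'I_m}} * {set tableau nu 'I_n})%type.

Definition pure_tensor (w : {ffun 'I_n -> freeQ {set tableau mu 'I_m}})
    (z : freeQ {set tableau nu 'I_n}) : freeQ oslash_base :=
  [ffun y : oslash_base => (\prod_i (w i (y.1 i) : rat)) * z y.2].

Definition polytensor (t : {ffun 'I_n -> tableau mu 'I_m}) (u : tableau nu 'I_n) :
  freeQ oslash_base :=
  pure_tensor [ffun i => polytabloid (t i)] (polytabloid u).

(* The element (h, pi) of S_m wr S_n sends the factor in position i to position
   pi i, after acting on it by h i. *)
Definition wreath_act (h : {ffun 'I_n -> 'S_m}) (pi : 'S_n) (y : oslash_base) :
  oslash_base :=
  ([ffun k => specht_action mu 'I_m (y.1 ((pi^-1)%g k)) (h ((pi^-1)%g k))],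
   specht_action nu 'I_n y.2 pi).

(* s is the image of (h, pi) in the imprimitive subgroup of Sym(Om). *)
Definition wreath_image (h : {ffun 'I_n -> 'S_m}) (pi : 'S_n) (s : {perm Om}) :
  bool :=
  [forall i, [forall j, s (beta (i, j)) == beta (pi i, h i j)]].

Lemma wreath_act_inj h pi : injective (wreath_act h pi).
Proof.
move=> [x y] [x' y'] [/ffunP ex ey].
have -> : y = y' := act_inj (specht_action nu 'I_n) pi ey.
congr (_, _); apply/ffunP=> i; have := ex (pi i); rewrite !ffunE permK.
exact: (act_inj (specht_action mu 'I_m) (h i)).
Qed.

Lemma wreath_act_polytensor h pi t u :
  push (wreath_act h pi) (polytensor t u) =
  polytensor [ffun k => tab_action 'P mu (t ((pi^-1)%g k)) (h ((pi^-1)%g k))]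
             (tab_action 'P nu u pi).
Proof.
have winj := @wreath_act_inj h pi.
apply/ffunP=> y; have [f _ fK] := injF_bij winj; rewrite -[y]fK.
move: {y}(f y) => [x y]; rewrite push_inj // !ffunE /=.
rewrite -polytabloid_act (push_inj _ _ (act_inj _ pi)); congr (_ * _).
rewrite [RHS](reindex_inj (@perm_inj _ pi)) /=; apply: eq_bigr => i _.
by rewrite !ffunE permK -polytabloid_act (push_inj _ _ (act_inj _ (h i))).
Qed.

(* (S^mu (/) S^nu) (x)_{Q[S_m wr S_n]} Q Sym(Om), where v (x) g is the function
   push (pair g) v supported on {g}. *)
Definition induced_act (x : {perm Om} * oslash_base) (a : {perm Om}) :
  {perm Om} * oslash_base := ((x.1 * a)%g, x.2).

Lemma induced_act1 : induced_act^~ 1%g =1 id.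
Proof. by case=> g y; rewrite /induced_act mulg1. Qed.

Lemma induced_actM : forall x, act_morph induced_act x.
Proof. by case=> g y a b; rewrite /induced_act mulgA. Qed.

Canonical induced_action := TotalAction induced_act1 induced_actM.

Definition tensor_at (g : {perm Om}) (v : freeQ oslash_base) :
  freeQ ({perm Om} * oslash_base)%type := push (pair g) v.

Definition foulkes_space : {vspace freeQ ({perm Om} * oslash_base)%type} :=
  (\sum_(g : {perm Om})
   \sum_(t : {ffun 'I_n -> tableau mu 'I_m} | [forall i, injectiveb (t i)])
   \sum_(u : tableau nu 'I_n | injectiveb u) <[tensor_at g (polytensor t u)]>)%VS.

Definition foulkes_rel : {vspace freeQ ({perm Om} * oslash_base)%type} :=
  (\sum_(g : {perm Om})
   \sum_(t : {ffun 'I_n -> tableau mu 'I_m} | [forall i, injectiveb (t i)])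
   \sum_(u : tableau nu 'I_n | injectiveb u)
   \sum_(h : {ffun 'I_n -> 'S_m}) \sum_(pi : 'S_n)
   \sum_(s : {perm Om} | wreath_image h pi s)
     <[tensor_at g (push (wreath_act h pi) (polytensor t u))
       - tensor_at (s * g)%g (polytensor t u)]>)%VS.

Lemma tensor_at_act g a v :
  push (induced_action^~ a) (tensor_at g v) = tensor_at (g * a)%g v.
Proof. by rewrite /tensor_at push_comp; apply: eq_push. Qed.

Lemma mem_foulkes_space g (t : {ffun 'I_n -> tableau mu 'I_m})
    (u : tableau nu 'I_n) : [forall i, injectiveb (t i)] -> injectiveb u ->
  tensor_at g (polytensor t u) \in foulkes_space.
Proof.
by move=> ti ui; rewrite memvE (sumv_sup g) // (sumv_sup t) // (sumv_sup u).
Qed.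

Lemma foulkes_rel_sub : (foulkes_rel <= foulkes_space)%VS.
Proof.
apply/subv_sumP=> g _; apply/subv_sumP=> t ti; apply/subv_sumP=> u ui.
apply/subv_sumP=> h _; apply/subv_sumP=> pi _; apply/subv_sumP=> s _.
rewrite -memvE memvB ?mem_foulkes_space // wreath_act_polytensor.
rewrite mem_foulkes_space ?injective_tabact //.
by apply/forallP=> k; rewrite ffunE injective_tabact // (forallP ti).
Qed.

Lemma foulkes_stable a v : v \in foulkes_space ->
  push (induced_action^~ a) v \in foulkes_space.
Proof.
apply: memv_sum_line_map => g x _; apply: memv_sum_line_map => t y ti.
apply: memv_sum_line_map => u z ui; apply: memv_line_map (tensor_at_act _ _ _) _.
by rewrite mem_foulkes_space.
Qed.

Lemma foulkes_rel_stable a v : v \in foulkes_rel ->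
  push (induced_action^~ a) v \in foulkes_rel.
Proof.
apply: memv_sum_line_map => g ? _; apply: memv_sum_line_map => t ? ti.
apply: memv_sum_line_map => u ? ui; apply: memv_sum_line_map => h ? _.
apply: memv_sum_line_map => pi ? _; apply: memv_sum_line_map => s ? si.
have e : push (induced_action^~ a)
    (tensor_at g (push (wreath_act h pi) (polytensor t u))
     - tensor_at (s * g)%g (polytensor t u)) =
    tensor_at (g * a)%g (push (wreath_act h pi) (polytensor t u))
     - tensor_at (s * (g * a))%g (polytensor t u).
  by rewrite linearB /= !tensor_at_act mulgA.
apply: memv_line_map e _; rewrite memvE.
rewrite (sumv_sup (g * a)%g) // (sumv_sup t) // (sumv_sup u) //.
by rewrite (sumv_sup h) // (sumv_sup pi) // (sumv_sup s).
Qed.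

Definition foulkes : gmodule {perm Om} :=
  GModule foulkes_rel_sub foulkes_stable foulkes_rel_stable.

End Foulkes.

Section Homomorphisms.
Variables (m n : nat) (mu nu la : seq nat).
Variable beta : 'I_n * 'I_m -> Omega la.

Local Notation Mt := (M_tilde la (Omega la)).
Local Notation Sp := (specht la (Omega la)).
Local Notation H := (foulkes mu nu beta).

Definition is_fbar (T : family_tuple mu (kappa m nu))
    (f : 'Hom(carrier Mt, carrier (N_mod_C mu nu la))) : Prop :=
  is_hom f /\
  exists2 TT, is_T_of_family T TT &
    f (coset_mod (M := Mt) (dirac (t_la la))) =
    coset_mod (M := N_mod_C mu nu la)
      (\sum_(th in Isym la) \sum_(s in CPP nu) \sum_(r in ffun_on (mem (RPP mu)))
         (sgn th * sgn s) *:
           dirac (tabloid (star (tmove (tt_action mu nu la TT th) s) r))).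

Definition is_gbar (T : family_tuple mu (kappa m nu))
    (f : 'Hom(carrier Mt, carrier (Nt_mod_Ct mu nu la))) : Prop :=
  is_hom f /\
  exists2 TT, is_T_of_family T TT &
    f (coset_mod (M := Mt) (dirac (t_la la))) =
    coset_mod (M := Nt_mod_Ct mu nu la)
      (\sum_(th in Isym la) \sum_(s in RPP nu) \sum_(r in ffun_on (mem (RPP mu)))
         sgn th *: dirac (star (tmove (tt_action mu nu la TT th) s) r)).

(* foulkes is H_mu^nu, which iota identifies with a submodule of Q. *)
Definition identifies (Q : gmodule {perm Omega la})
    (iota : 'Hom(carrier H, carrier Q)) : Prop :=
  is_hom iota /\ lker iota = 0%VS.

(* F : S^la -> H_mu^nu is the homomorphism through which f factors along |t| |-> e(t). *)
Definition is_induced (Q : gmodule {perm Omega la})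
    (iota : 'Hom(carrier H, carrier Q)) (f : 'Hom(carrier Mt, carrier Q))
    (F : 'Hom(carrier Sp, carrier H)) : Prop :=
  is_hom F /\
  forall t : tableau la (Omega la), injective t ->
    iota (F (coset_mod (M := Sp) (polytabloid t))) =
    f (coset_mod (M := Mt) (dirac t)).

End Homomorphisms.

(* Main.v *)
(* Suppose a linear combination of the homomorphisms vanishes, and let e be
   maximal with a nonzero coefficient. Evaluating at the image of |t_la| gives a
   relation between the sums that define the homomorphisms. It is tested with the
   functional that counts, with signs, the ways to reach T_e := T_(T^(e)) from a
   given element of calN by CPP(mu)^n together with RPP(nu) (m even) or CPP(nu)
   (m odd); it vanishes on C, respectively on C~.
   If T_c leads to T_e then, on numbers, each t in T^(e) has the columns of some
   u.s with u in T^(c) and s in RPP(mu). As the rows of u increase strictly, a row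
   permutation can only lower the columns of u, so t is below u in the column
   order; for c < e this excludes t = s^(e). When c = e, column sums force the row
   permutations of the mu-tableaux to be trivial, then those of the strictly
   sorted rows of kappa; what remains is a permutation of blocks of size m with
   column permutations inside them, and its sign cancels all the others. So every
   contribution is positive. *)
Require Import Defs.
From HB Require Import structures.
From mathcomp Require Import all_boot all_order all_fingroup all_algebra finmap.
Set Implicit Arguments.
Unset Strict Implicit.
Unset Printing Implicit Defensive.
Import GRing.Theory Num.Theory.
Local Open Scope ring_scope.

(** * Signs of permutations, in particular of a product of two sets *)

Lemma sgnM (T : finType) (s t : {perm T}) : sgn (s * t)%g = sgn s * sgn t.
Proof. by rewrite /sgn odd_permM signr_addb. Qed.

Lemma sgn1 (T : finType) : sgn (1%g : {perm T}) = 1.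
Proof. by rewrite /sgn odd_perm1. Qed.

Lemma sgn_sqr (T : finType) (s : {perm T}) : sgn s * sgn s = 1.
Proof. by rewrite /sgn -signr_addb addbb. Qed.

(** Write [s] as a product of transpositions. Since [h] is injective, it carries each of them to a
    transposition of [B], and [u] is the product of these images; the induction strips one factor
    from both sides. *)
Lemma sgn_embed (A B : finType) (h : A -> B) (s : {perm A}) (u : {perm B}) :
  injective h -> (forall a, u (h a) = h (s a)) ->
  (forall b, b \notin codom h -> u b = b) -> sgn u = sgn s.
Proof.
move=> h_inj; have [ts -> ts_neq] := prod_tpermP s.
elim: ts ts_neq u => [_ u uh u0|[a b] ts IH /= /andP[ab ts_neq] u uh u0].
  rewrite big_nil; suff -> : u = 1%g by rewrite !sgn1.
  apply/permP=> x; rewrite perm1; have [/codomP[a ->]|/u0//] := boolP (x \in codom h).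
  by rewrite uh big_nil perm1.
rewrite big_cons sgnM -(IH ts_neq (tperm (h a) (h b) * u)%g).
- have sgn_tperm (C : finType) (x y : C) : x != y -> sgn (tperm x y) = -1.
    by rewrite /sgn odd_tperm => ->.
  by rewrite sgnM !sgn_tperm ?(inj_eq h_inj) // !mulN1r opprK.
- move=> x; rewrite permM (_ : tperm (h a) (h b) (h x) = h (tperm a b x)).
    by rewrite uh big_cons permM tpermK.
  exact/esym/inj_tperm.
move=> x xh; rewrite permM tpermD ?u0 //.
  by apply: contraNneq xh => <-; apply: codom_f.
by apply: contraNneq xh => <-; apply: codom_f.
Qed.

Section PermProduct.
Variables P Q : finType.

Lemma fiber_perm_inj (s : P -> {perm Q}) :
  injective (fun x : P * Q => (x.1, s x.1 x.2)).
Proof. by move=> [p q] [p' q'] /= [<- /perm_inj ->]. Qed.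

Definition fiber_perm (s : P -> {perm Q}) : {perm P * Q} :=
  perm (fiber_perm_inj (s := s)).

(** The fibers are switched on one at a time along a list; each new one contributes the sign of a
    permutation embedded by [pair p]. *)
Lemma sgn_fiber_perm (s : P -> {perm Q}) : sgn (fiber_perm s) = \prod_p sgn (s p).
Proof.
suff partial l : uniq l ->
    sgn (fiber_perm (fun p => if p \in l then s p else 1%g)) = \prod_(p <- l) sgn (s p).
  have := partial (enum P) (enum_uniq P); rewrite big_enum /= => <-; congr sgn.
  by apply/permP=> -[p q]; rewrite !permE /= mem_enum.
elim: l => [_|p l IH /= /andP[pl l_uniq]].
  rewrite big_nil; suff -> : fiber_perm (fun p => if p \in [::] then s p else 1%g) = 1%g.
    by rewrite sgn1.
  by apply/permP=> -[p q]; rewrite permE /= !perm1.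
rewrite big_cons -IH //.
rewrite -(@sgn_embed _ _ (pair p) (s p)
  (fiber_perm (fun p' => if p' == p then s p else 1%g))).
- rewrite -sgnM; congr sgn; apply/permP=> -[p' q]; rewrite permM !permE /= inE.
  by have [->|] := eqVneq p' p; rewrite /= ?perm1 // (negPf pl) perm1.
- by move=> ? ? [].
- by move=> q; rewrite permE /= eqxx.
move=> [p' q] pq; rewrite permE /=; case: eqP pq => [->|_ _]; last by rewrite perm1.
by rewrite codom_f.
Qed.

Lemma block_perm_inj (t : {perm P}) : injective (fun x : P * Q => (t x.1, x.2)).
Proof. by move=> [p q] [p' q'] /= [/perm_inj <- ->]. Qed.

Definition block_perm (t : {perm P}) : {perm P * Q} := perm (block_perm_inj (t := t)).

End PermProduct.

(** Exchanging the two factors turns moving whole blocks into [#|Q|] parallel copies of [t]. This is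
    where the parity of the block size enters. *)
Lemma sgn_block_perm (P Q : finType) (t : {perm P}) :
  sgn (block_perm Q t) = sgn t ^+ #|Q|.
Proof.
rewrite -prodr_const -[RHS](sgn_fiber_perm (fun _ : Q => t)).
apply: (@sgn_embed _ _ (fun x : Q * P => (x.2, x.1))).
- by move=> [? ?] [? ?] [-> ->].
- by move=> [q p]; rewrite !permE.
by move=> [p q] /negP[]; apply/codomP; exists (q, p).
Qed.

(** * Permutations inside rows with strictly increasing entries *)

(** If [s b] lies beyond column [j], then [s] fixes it and [s b = b] by injectivity; otherwise [s b]
    is [b] or lies to its left in the same row. The boxes are abstract so that the argument covers
    one mu-tableau, all mu-tableaux at once, and the array of mu-tableaux itself. *)
Lemma strict_row_le (B : finType) (R : eqType) (r : B -> R) (c t : B -> nat)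
    (s : {perm B}) (j : nat) :
  (forall b, r (s b) = r b) ->
  (forall b b', r b = r b' -> c b = c b' -> b = b') ->
  (forall b b', r b = r b' -> (c b < c b')%N -> (t b < t b')%N) ->
  (forall b, (j < c b)%N -> s b = b) ->
  forall b, c b = j -> (t (s b) <= t b ?= iff (s b == b))%N.
Proof.
move=> rs rc_inj t_lt fixed b cb; have [/fixed/perm_inj sb|sb_le] := ltnP j (c (s b)).
  by rewrite sb eqxx; split; rewrite ?eqxx.
have [e|csb] := eqVneq (c (s b)) (c b).
  by rewrite (rc_inj _ _ (rs b) e); split; rewrite ?eqxx.
have lt_t : (t (s b) < t b)%N by rewrite t_lt // ltn_neqAle csb cb.
split; first exact: ltnW.
by rewrite (ltn_eqF lt_t); apply/esym; apply: contra_neqF csb => /eqP->.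
Qed.

(* Working from the rightmost column, a permutation inside the rows can only
   decrease column sums, and preserves them only if it is trivial there. *)
Lemma strict_row_fixed (B : finType) (R : eqType) (r : B -> R) (c t : B -> nat)
    (s : {perm B}) (j0 : nat) :
  (forall b, r (s b) = r b) ->
  (forall b b', r b = r b' -> c b = c b' -> b = b') ->
  (forall b b', r b = r b' -> (c b < c b')%N -> (t b < t b')%N) ->
  (forall j, (j0 <= j)%N ->
     (\sum_(b | c b == j) t (s b) = \sum_(b | c b == j) t b)%N) ->
  forall b, (j0 <= c b)%N -> s b = b.
Proof.
move=> rs rc_inj t_lt sums.
(* Induction on the number [n] of rightmost columns already shown to be fixed; for [n = 0] no box
   qualifies. *)
suff fixed n b : (j0 <= c b)%N -> (\max_b c b < c b + n)%N -> s b = b.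
  move=> b jb; apply: (fixed (\max_b c b).+1) => //; rewrite addnS ltnS; exact: leq_addl.
elim: n b => [|n IH] b jb; first by rewrite addn0 ltnNge leq_bigmax.
rewrite addnS ltnS => maxb.
have fixed b' : (c b < c b')%N -> s b' = b'.
  move=> bb'; apply: IH; first exact: leq_trans jb (ltnW bb').
  by apply: leq_ltn_trans maxb _; rewrite ltn_add2r.
have le_t b' : c b' == c b -> (t (s b') <= t b' ?= iff (s b' == b'))%N.
  by move/eqP; apply: strict_row_le.
(* Termwise inequalities with equal totals are equalities. *)
have [_] := leqif_sum le_t; rewrite sums // eqxx => /esym/forallP/(_ b).
by rewrite eqxx => /eqP.
Qed.

(** * Row and column groups, boxes and conjugate partitions *)

Lemma RPP_group_set (g : seq nat) : group_set (RPP g).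
Proof.
apply/group_setP; split=> [|s t]; first by rewrite inE; apply/forallP=> b; rewrite perm1.
rewrite !inE => /forallP sr /forallP tr; apply/forallP=> b.
by rewrite permM (eqP (tr _)) sr.
Qed.

Canonical RPP_group g := Group (RPP_group_set g).

Lemma CPP_group_set (g : seq nat) : group_set (CPP g).
Proof.
apply/group_setP; split=> [|s t]; first by rewrite inE; apply/forallP=> b; rewrite perm1.
rewrite !inE => /forallP sr /forallP tr; apply/forallP=> b.
by rewrite permM (eqP (tr _)) sr.
Qed.

Canonical CPP_group g := Group (CPP_group_set g).

Lemma RPP_row (g : seq nat) (s : {perm box g}) b : s \in RPP g -> row_of (s b) = row_of b.
Proof. by rewrite inE => /forallP/(_ b)/eqP. Qed.

Lemma CPP_col (g : seq nat) (s : {perm box g}) b : s \in CPP g -> col_of (s b) = col_of b.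
Proof. by rewrite inE => /forallP/(_ b)/eqP. Qed.

Lemma tmove_tmove (g : seq nat) (X : Type) (t : tableau g X) s s' :
  tmove (tmove t s) s' = tmove t (s * s')%g.
Proof. by apply/ffunP=> b; rewrite !ffunE invMg permM. Qed.

Lemma box_inj (g : seq nat) (b b' : box g) :
  row_of b = row_of b' -> col_of b = col_of b' -> b = b'.
Proof.
case: b b' => [i j] [i' j']; rewrite /row_of /col_of /= => /val_inj ii'.
by rewrite {i}ii' in j * => /val_inj ->.
Qed.

Lemma box_exists (g : seq nat) i j : (j < nth 0%N g i)%N ->
  exists b : box g, row_of b = i /\ col_of b = j.
Proof.
move=> jg; have ig : (i < size g)%N by rewrite ltnNge; apply: contraL jg => /(nth_default _) ->.
by exists (@Tagged _ (Ordinal ig) (fun i : 'I_(size g) => 'I_(nth 0%N g i)) (Ordinal jg)).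
Qed.

Lemma box_bound (g : seq nat) (b : box g) : (col_of b < nth 0%N g (row_of b))%N.
Proof. exact: ltn_ord. Qed.

Lemma card_box (g : seq nat) : #|{: box g}| = sumn g.
Proof.
rewrite card_tagged sumnE big_map big_enum /= sumnE (big_nth 0%N) big_mkord.
by apply: eq_bigr => i _; rewrite card_ord.
Qed.

(** In a weakly decreasing sequence the parts larger than [j] form an initial segment. *)
Lemma nth_gt_count (p : seq nat) i j : sorted geq p ->
  (j < nth 0%N p i)%N = (i < count (fun r => j < r)%N p)%N.
Proof.
elim: p i => [|x p IH] i /= xp; first by rewrite nth_nil.
have /IH {}IH := path_sorted xp.
case: (ltnP j x) => jx; first by case: i => //= i; rewrite add1n IH.
have /allP p_le : all (geq x) p by apply: order_path_min xp => a b c /= ab bc; apply: leq_trans bc ab.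
have count0 : count (fun r => j < r)%N p = 0%N.
  apply/eqP; rewrite -leqn0 leqNgt -has_count; apply/hasPn=> y /p_le yx.
  by rewrite -leqNgt (leq_trans yx jx).
by case: i => [|i] /=; rewrite ?IH count0 // ltnNge jx.
Qed.

Lemma conj_partP (p : seq nat) i j : sorted geq p ->
  (i < nth 0%N (conj_part p) j)%N = (j < nth 0%N p i)%N.
Proof.
move=> p_sorted; rewrite [RHS]nth_gt_count //.
have [jp|jp] := ltnP j (head 0%N p); first by rewrite /conj_part nth_mkseq.
have : (0 < count (fun r => j < r)%N p)%N = false.
  by rewrite -nth_gt_count // nth0 ltnNge jp.
by rewrite nth_default ?size_mkseq //; case: count.
Qed.

(** * Column multisets and the column order *)

Lemma perm_col_entries_move (mu : seq nat) (t : tableau mu nat) s j :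
  s \in CPP mu -> perm_eq (col_entries (tmove t s) j) (col_entries t j).
Proof.
move=> sC; have sVC : (s^-1)%g \in CPP mu by rewrite groupV.
have -> : col_entries (tmove t s) j =
    map t (map (s^-1)%g [seq b <- enum {: box mu} | col_of b == j]).
  by rewrite -map_comp; apply: eq_map => b; rewrite /= ffunE.
apply: perm_map; apply: uniq_perm.
- by rewrite (map_inj_uniq (@perm_inj _ (s^-1)%g)); apply/filter_uniq/enum_uniq.
- exact/filter_uniq/enum_uniq.
move=> b; rewrite mem_filter mem_enum andbT; apply/mapP/eqP=> [[b']|bj].
  by rewrite mem_filter => /andP[/eqP b'j _] ->; rewrite CPP_col.
by exists (s b); rewrite ?permK // mem_filter mem_enum andbT CPP_col // bj.
Qed.

Lemma sumn_col_entries (mu : seq nat) (t : tableau mu nat) j :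
  sumn (col_entries t j) = (\sum_(b | col_of b == j) t b)%N.
Proof. by rewrite sumnE big_map big_filter big_enum_cond. Qed.

Lemma count_col_entries (mu : seq nat) (t : tableau mu nat) j a :
  count a (col_entries t j) = #|[set b | (col_of b == j) && a (t b)]|.
Proof.
rewrite cardsE cardE /enum_mem size_filter count_map count_filter enumT.
by apply: eq_count => b; rewrite /= andbC.
Qed.

Lemma size_col_entries (mu : seq nat) (t : tableau mu nat) j :
  (size (col_entries t j) <= size mu)%N.
Proof.
rewrite size_map; set l := filter _ _.
rewrite -(size_map (fun b : box mu => tag b) l) -[leqRHS]size_enum_ord.
apply: uniq_leq_size => [|i _]; last by rewrite mem_enum.
rewrite map_inj_in_uniq; first exact/filter_uniq/enum_uniq.
move=> b b'.
rewrite !mem_filter => /andP[/eqP bj _] /andP[/eqP b'j _] /(congr1 val) r.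
by apply: box_inj; rewrite // bj b'j.
Qed.

Lemma size_col_entries_eq (mu : seq nat) (u v : tableau mu nat) j :
  size (col_entries u j) = size (col_entries v j).
Proof. by rewrite !size_map. Qed.

Lemma col_entries_nil (mu : seq nat) (t : tableau mu nat) j :
  (forall b : box mu, (col_of b < j)%N) -> col_entries t j = [::].
Proof.
move=> bj; rewrite /col_entries (eq_filter (a2 := pred0)) ?filter_pred0 // => b.
by rewrite /= ltn_eqF.
Qed.

(** By symmetry it suffices to exclude [g b < f b]. Count the entries at most [g b] in the column of
    [b]: for [g] they fill [b] and all boxes above it, for [f] only boxes strictly above it, since
    the columns increase weakly. *)
Lemma conj_semistandard_eq (mu : seq nat) (u v : tableau mu nat) :
  conj_semistandard u -> conj_semistandard v ->
  (forall j, perm_eq (col_entries u j) (col_entries v j)) -> u = v.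
Proof.
suff le (f g : tableau mu nat) : conj_semistandard f -> conj_semistandard g ->
    (forall j, perm_eq (col_entries f j) (col_entries g j)) -> forall b, (f b <= g b)%N.
  move=> u_csst v_csst uv; apply/ffunP=> b.
  by apply/eqP; rewrite eqn_leq !le // => j; rewrite perm_sym.
move=> [_ _ f_le] [_ _ g_le] fg b; rewrite leqNgt; apply/negP=> gf.
have /seq.permP/(_ (fun x => x <= g b)%N) := fg (col_of b).
rewrite !count_col_entries => e.
pose below := [set b' : box mu | (col_of b' == col_of b) && (row_of b' < row_of b)%N].
suff : (#|b |: below| <= #|below|)%N by rewrite cardsU1 inE ltnn andbF ltnn.
apply: (@leq_trans #|[set b' | (col_of b' == col_of b) && (g b' <= g b)%N]|).
  apply/subset_leq_card/subsetP=> b'; rewrite !inE.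
  by case/orP=> [/eqP->|/andP[/eqP cb' rb']]; rewrite ?eqxx ?leqnn // cb' eqxx g_le.
rewrite -e; apply/subset_leq_card/subsetP=> b'; rewrite !inE => /andP[/eqP cb' fb'].
rewrite cb' eqxx ltnNge; apply: contraL (leq_ltn_trans fb' gf).
rewrite -leqNgt leq_eqVlt => /orP[/eqP r|]; last by apply: f_le.
by rewrite (box_inj r).
Qed.

Lemma all2_map (X Y Z : Type) (r : Y -> Z -> bool) (f : X -> Y) (g : X -> Z) (l : seq X) :
  all2 r (map f l) (map g l) = all (fun x => r (f x) (g x)) l.
Proof. by elim: l => //= x l ->. Qed.

(** Let [j] be the rightmost column whose multiset changes. The columns to its right keep their
    sums, so the row permutation fixes them, and [strict_row_le] applies in column [j]. The column
    permutation [p] does not affect the multisets. *)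
Lemma col_le_row_move (mu : seq nat) (t : tableau mu nat) s p :
  conj_semistandard t -> s \in RPP mu -> p \in CPP mu ->
  col_le (tmove (tmove t s) p) t.
Proof.
move=> [_ t_lt _] sR pC; set u := tmove t s.
have uP j := perm_col_entries_move u j pC.
have uE b : u b = t ((s^-1)%g b) by rewrite ffunE.
have rs b : row_of ((s^-1)%g b) = row_of b by rewrite RPP_row // groupV.
pose differ j := ~~ perm_eq (col_entries (tmove u p) j) (col_entries t j).
pose M := (\max_(b : box mu) col_of b).+1.
have [/existsP[j0 d0]|/existsPn same] := boolP [exists j : 'I_M, differ j]; last first.
  left=> j; have [jM|Mj] := ltnP j M; first by have := same (Ordinal jM); rewrite negbK.
  by rewrite !col_entries_nil // => b; apply: leq_trans Mj; rewrite ltnS leq_bigmax.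
have differ_le j : differ j -> (j <= M)%N.
  apply: contraNT; rewrite -ltnNge => Mj.
  by rewrite !col_entries_nil // => b; apply: ltnW; apply: leq_trans Mj; rewrite !ltnS leq_bigmax.
case: (ex_maxnP (ex_intro differ _ d0) differ_le) => j dj j_max.
have same k : (j < k)%N -> perm_eq (col_entries (tmove u p) k) (col_entries t k).
  by move=> jk; apply: contraTT jk => /j_max; rewrite -leqNgt.
(* Both lists run through the boxes of column [j] in the same order, so the comparison is made box
   by box. *)
right; exists j; split=> //; exists (col_entries u j), (col_entries t j).
split; rewrite ?perm_refl // 1?perm_sym //.
rewrite all2_map; apply/allP=> b; rewrite mem_filter => /andP[/eqP bj _].
rewrite uE; apply: (strict_row_le rs (@box_inj mu) t_lt _ bj) => b' jb'.
apply: (strict_row_fixed rs (@box_inj mu) t_lt _ jb') => k jk.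
under eq_bigr do rewrite -uE.
rewrite -!sumn_col_entries !sumnE; apply: perm_big.
by apply: perm_trans (same _ jk); rewrite perm_sym.
Qed.

(** * The total order on conjugate-semistandard tableaux *)

Lemma csst_lt_irr (mu : seq nat) (u : tableau mu nat) : csst_lt u u = false.
Proof. by apply/existsP=> -[j]; rewrite eqxx. Qed.

Lemma csst_ltP (mu : seq nat) (u v : tableau mu nat) :
  let c (t : tableau mu nat) j := sort leq (col_entries t j) in
  reflect (exists (j : 'I_(head 0%N mu)) (q : 'I_(size mu)),
    [/\ forall k : 'I_(head 0%N mu), (j < k)%N -> c u k = c v k,
        (nth 0%N (c u j) q < nth 0%N (c v j) q)%N
      & forall i : 'I_(size mu), (q < i)%N -> nth 0%N (c u j) i = nth 0%N (c v j) i])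
  (csst_lt u v).
Proof.
apply: (iffP existsP) => [[j]|[j [q [same lt_q same_q]]]].
  case/and3P=> _ /forallP same /existsP[q /andP[lt_q /forallP same_q]].
  exists j, q; split=> // [k jk|i qi]; apply/eqP; first exact: (implyP (same k)).
  exact: (implyP (same_q i)).
exists j; apply/and3P; split.
- by apply: contraTneq lt_q => ->; rewrite ltnn.
- by apply/forallP=> k; apply/implyP=> /same/eqP.
by apply/existsP; exists q; rewrite lt_q; apply/forallP=> i; apply/implyP=> /same_q/eqP.
Qed.

Lemma csst_lt_trans (mu : seq nat) (u v w : tableau mu nat) :
  csst_lt u v -> csst_lt v w -> csst_lt u w.
Proof.
case/csst_ltP=> j [q [same lt_q same_q]] /csst_ltP[j' [q' [same' lt_q' same_q']]].
apply/csst_ltP; have [jj'|j'j|/val_inj jj'] := ltngtP j j'.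
- exists j', q'; split=> [k j'k||i qi]; last by rewrite same // same_q'.
    by rewrite same ?same' // (ltn_trans jj').
  by rewrite same.
- exists j, q; split=> [k jk||i qi]; last by rewrite -same' // same_q.
    by rewrite same ?same' // (ltn_trans j'j).
  by rewrite -same'.
rewrite -{}jj' in same' lt_q' same_q'.
have same'' (k : 'I_(head 0%N mu)) : (j < k)%N -> _ = _ :=
  fun jk => etrans (same k jk) (same' k jk).
have [qq'|q'q|/val_inj qq'] := ltngtP q q'.
- exists j, q'; split=> // [|i qi]; first by rewrite same_q.
  by rewrite same_q ?same_q' //; apply: ltn_trans qi.
- exists j, q; split=> // [|i qi]; first by rewrite -same_q'.
  by rewrite same_q ?same_q' //; apply: ltn_trans qi.
exists j, q; split=> // [|i qi]; first by rewrite (ltn_trans lt_q) // qq'.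
by rewrite same_q // same_q' // -qq'.
Qed.

Lemma max_difference n (P : pred 'I_n) i0 : P i0 ->
  exists2 i, P i & forall k : 'I_n, (i < k)%N -> ~~ P k.
Proof.
move=> Pi0; case: (arg_maxnP val Pi0) => i Pi i_max; exists i => // k ik.
by apply: contraL ik => /i_max; rewrite -leqNgt.
Qed.

(** [csst_lt] inspects the columns up to the first part of [mu]. As the parts decrease, these are
    all the columns, so tableaux that agree there have equal column multisets and coincide.
    Otherwise the last differing entry of the rightmost differing column decides. *)
Lemma csst_lt_total (mu : seq nat) (u v : tableau mu nat) :
  sorted geq mu -> conj_semistandard u -> conj_semistandard v ->
  [|| u == v, csst_lt u v | csst_lt v u].
Proof.
move=> mu_sorted uC vC; have [//|uv] := eqVneq u v.
pose c (t : tableau mu nat) j := sort leq (col_entries t j).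
have [j0 /= d0] : exists j : 'I_(head 0%N mu), c u j != c v j.
  apply/existsP; apply: contraNT uv; rewrite negb_exists => /forallP same.
  apply/eqP/(conj_semistandard_eq uC vC) => j.
  have [jmu|muj] := ltnP j (head 0%N mu).
    have := same (Ordinal jmu); rewrite negbK => /eqP e.
    by rewrite -(perm_sort leq) /= -[sort _ _]/(c u j) e perm_sort.
  suff out (b : box mu) : (col_of b < j)%N by rewrite !col_entries_nil.
  apply: leq_trans muj; have := box_bound b.
  by rewrite nth_gt_count // => /(leq_ltn_trans (leq0n _)); rewrite -nth_gt_count // nth0.
have [j /= dj j_max] := @max_difference _ (fun j : 'I_(head 0%N mu) => c u j != c v j) _ d0.
have [q0 /= e0] : exists q : 'I_(size mu), nth 0%N (c u j) q != nth 0%N (c v j) q.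
  apply/existsP; apply: contraNT dj; rewrite negb_exists => /forallP same.
  apply/eqP/(@eq_from_nth _ 0%N); rewrite !size_sort ?(size_col_entries_eq u v) // => i ic.
  have imu := leq_trans ic (size_col_entries v j).
  by have := same (Ordinal imu); rewrite negbK => /eqP.
have [q /= dq q_max] :=
  @max_difference _ (fun q : 'I_(size mu) => nth 0%N (c u j) q != nth 0%N (c v j) q) _ e0.
have same (k : 'I_(head 0%N mu)) : (j < k)%N -> c u k = c v k by move/j_max/negbNE/eqP.
have same_q (i : 'I_(size mu)) : (q < i)%N -> nth 0%N (c u j) i = nth 0%N (c v j) i.
  by move/q_max/negbNE/eqP.
move: dq; rewrite neq_ltn => /orP[lt_q|lt_q]; apply/orP; [left|right].
  by apply/csst_ltP; exists j, q.
by apply/csst_ltP; exists j, q; split=> // k kk; apply/esym; [exact: same|exact: same_q].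
Qed.

(** * Matches between the tableaux of family tuples *)

Section Matching.
Variables (mu nu la : seq nat).
Local Notation tt := (tableau nu (tableau mu (Omega la))).

Definition numbers (T : tt) : tableau nu (tableau mu nat) :=
  relabel (relabel (@symbol_number la)) T.

(** [th] changes only the indices of symbols, so on numbers it disappears and only place
    permutations remain. *)
Lemma numbers_match (T0 T1 : tt) th s x t r : th \in Isym la ->
  star (tmove (star (tmove (tt_action mu nu la T1 th) s) x) t) r = T0 ->
  forall p, numbers T0 p =
    tmove (tmove (numbers T1 ((s^-1)%g ((t^-1)%g p))) (x ((t^-1)%g p))) (r p).
Proof.
rewrite inE => /forallP thI <- p; apply/ffunP=> q.
by rewrite !ffunE /= apermE (eqP (thI _)).
Qed.

Lemma col_le_match (T0 T1 : tt) th s x t r : th \in Isym la ->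
  x \in ffun_on (mem (RPP mu)) -> r \in ffun_on (mem (CPP mu)) ->
  (forall p, conj_semistandard (numbers T1 p)) ->
  star (tmove (star (tmove (tt_action mu nu la T1 th) s) x) t) r = T0 ->
  forall p, exists p', col_le (numbers T0 p) (numbers T1 p').
Proof.
move=> thI /ffun_onP xR /ffun_onP rC T1C /(numbers_match thI) e p.
by exists ((s^-1)%g ((t^-1)%g p)); rewrite e; apply: col_le_row_move; [|exact: xR|exact: rC].
Qed.

(** The entries of [T] identify pairs of boxes with symbols, bijectively because [T] lies in [calN].
    Under this identification [th] moves the blocks by [t] and then permutes inside them by [r]. *)
Lemma sgn_match (T : tt) th t r : T \in calN mu nu la ->
  injective (fun pq : box nu * box mu => T pq.1 pq.2) ->
  star (tmove (tt_action mu nu la T th) t) r = T ->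
  sgn th = sgn t ^+ #|{: box mu}| * sgn_family r.
Proof.
move=> TN T_inj e.
rewrite -sgn_block_perm -[sgn_family r](sgn_fiber_perm (fun p => r p)) -sgnM.
apply: (@sgn_embed _ _ (fun pq : box nu * box mu => T pq.1 pq.2)) => //.
  by move=> [p q]; rewrite permM !permE /= -[in RHS]e !ffunE /= !permK apermE.
move=> w /negP[]; move: TN; rewrite inE => /andP[_ /forallP/(_ w)].
by move=> /existsP[p /existsP[q /eqP <-]]; apply/codomP; exists (p, q).
Qed.

(** [a] and [d] are the row and column coordinates in the shape kappa, kept abstract because they
    are swapped on [nu] when m is even. Strict increase along rows is used twice: inside the
    mu-tableaux it removes [x], and between the mu-tableaux in a row of kappa it removes [s]. *)
Lemma match_self (a d : box nu -> nat) (T : tt) th (s t : {perm box nu}) x r :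
  (forall b, a (s b) = a b) -> (forall b, d (t b) = d b) ->
  (forall b b', a b = a b' -> d b = d b' -> b = b') ->
  (forall b b', a b = a b' -> (d b < d b')%N ->
     csst_lt (numbers T b) (numbers T b')) ->
  (forall p, conj_semistandard (numbers T p)) ->
  th \in Isym la -> x \in ffun_on (mem (RPP mu)) -> r \in ffun_on (mem (CPP mu)) ->
  star (tmove (star (tmove (tt_action mu nu la T th) s) x) t) r = T ->
  s = 1%g /\ x = [ffun=> 1%g].
Proof.
move=> sa td ad_inj a_lt TC thI /ffun_onP xR /ffun_onP rC /(numbers_match thI).
set S := numbers T in a_lt TC * => e.
have sVa b : a ((s^-1)%g b) = a b by rewrite -[in RHS](permKV s b) sa.
have tVd b : d ((t^-1)%g b) = d b by rewrite -[in RHS](permKV t b) td.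
(* All the mu-tableaux together form one diagram, on [box nu * box mu], whose
   total column sums are not changed by [s], [t] and [r]. *)
have x1 p : x (s p) = 1%g.
  (* The tableau at [p] is first carried to [s p], so the row permutation that meets it is
     [x (s p)]. *)
  pose X := fiber_perm (fun p => ((x (s p))^-1)%g).
  have XE p' q : X (p', q) = (p', ((x (s p'))^-1)%g q) by rewrite permE.
  have xVR p' b : row_of (((x p')^-1)%g b) = row_of b by rewrite RPP_row // groupV.
  have fixX : forall b, (0 <= col_of b.2)%N -> X b = b.
    apply: (@strict_row_fixed _ _ (fun b => (b.1, row_of b.2)) (fun b => col_of b.2)
              (fun b => S b.1 b.2)).
    - by move=> [p' q]; rewrite XE /= xVR.
    - by move=> [p1 q1] [p2 q2] /= [-> r12] /(box_inj r12) ->.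
    - move=> [p1 q1] [p2 q2] /= [-> r12]; have [_ S_lt _] := TC p2; exact: S_lt.
    move=> j _.
    have by_box (f : box nu * box mu -> nat) : (\sum_(b | col_of b.2 == j) f b =
        \sum_p \sum_(q | col_of q == j) f (p, q))%N.
      by rewrite pair_big_dep; apply: eq_bigr => -[].
    rewrite !by_box /=.
    (* Reindexing pairs matched tableaux: the one at [t p'] is the one at [s^-1 p'], moved by [x p']
       and a column permutation. *)
    rewrite (reindex_inj (@perm_inj _ (s^-1)%g)) [RHS](reindex_inj (@perm_inj _ t)) /=.
    apply: eq_bigr => p' _; rewrite -!sumn_col_entries e permK.
    rewrite (perm_sumn (perm_col_entries_move _ _ (rC _))) sumn_col_entries.
    by apply: eq_bigr => q _; rewrite XE /= [RHS]ffunE permKV.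
  apply/permP=> q; have := fixX (p, x (s p) q) (leq0n _).
  by rewrite XE permK perm1 => -[<-].
have x_id p : x p = 1%g by rewrite -(permKV s p) x1.
split; last by apply/ffunP=> p; rewrite ffunE x_id.
(* With trivial row permutations, matched tableaux have the same column multisets and hence
   coincide. *)
have S_fix p : S ((s^-1)%g ((t^-1)%g p)) = S p.
  apply: conj_semistandard_eq => // j; rewrite [S p]e x_id perm_sym.
  have -> (u : tableau mu nat) : tmove u 1%g = u.
    by apply/ffunP=> q; rewrite ffunE invg1 perm1.
  exact: perm_col_entries_move (rC p).
(* The rank turns [csst_lt] into the order of nat. *)
pose w b := #|[set b' | csst_lt (S b') (S b)]|.
have wE b b' : S b = S b' -> w b = w b' by rewrite /w => ->.
suff sV1 (b : box nu) : (s^-1)%g b = b by apply/permP=> b; rewrite perm1 -{1}(sV1 b) permKV.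
apply: (@strict_row_fixed _ _ a d w _ 0) => //.
  move=> b1 b2 a12 d12; apply/proper_card/properP; split.
    by apply/subsetP=> b'; rewrite !inE => /csst_lt_trans; apply; apply: a_lt.
  by exists b1; rewrite !inE ?csst_lt_irr ?a_lt.
move=> j _; rewrite (reindex_inj (@perm_inj _ (t^-1)%g)) /=.
by apply: eq_big => [b'|b' _]; rewrite ?tVd //; apply: wE.
Qed.

End Matching.

(** * Sorted families and the numbering by symbols *)

Lemma csst_le_trans (mu : seq nat) : transitive (@csst_le mu).
Proof.
move=> v u w /orP[/eqP->//|uv] /orP[/eqP<-|vw]; first by rewrite /csst_le uv orbT.
by rewrite /csst_le (csst_lt_trans uv vw) orbT.
Qed.

(** Sorting needs totality on the members of [A], which [csst_lt_total] provides; the members are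
    distinct, so the increase is strict. *)
Lemma sorted_csst_lt (mu : seq nat) (A : {fset tableau mu nat}) x0 i j :
  sorted geq mu -> (forall t, t \in A -> conj_semistandard t) ->
  (i < j)%N -> (j < #|` A|)%N ->
  csst_lt (nth x0 (sort (@csst_le mu) A) i) (nth x0 (sort (@csst_le mu) A) j).
Proof.
move=> mu_sorted AC ij jA; set s := sort _ _.
have s_sorted : sorted (@csst_le mu) s.
  apply: (sort_sorted_in (P := mem A)); last by apply/allP.
  move=> u v /AC uC /AC vC; rewrite /csst_le (eq_sym v u).
  by case/or3P: (csst_lt_total mu_sorted uC vC) => ->; rewrite ?orbT.
have size_s : size s = #|` A| by rewrite size_sort.
have js : (j < size s)%N by rewrite size_s.
have is_ : (i < size s)%N := ltn_trans ij js.
have := sorted_ltn_nth (@csst_le_trans mu) x0 s_sorted i j is_ js ij.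
by rewrite /csst_le nth_uniq ?sort_uniq ?fset_uniq // (ltn_eqF ij).
Qed.

Lemma lexlt_trans : transitive lexlt.
Proof.
move=> [a b] [c d] [e f]; rewrite /lexlt /= => /orP[h|/andP[/eqP-> h]] /orP[k|/andP[/eqP<- k]].
- by rewrite (ltn_trans h k).
- by rewrite h.
- by rewrite k.
by rewrite eqxx (ltn_trans h k) orbT.
Qed.

Lemma lexlt_irr : irreflexive lexlt.
Proof. by move=> [a b]; rewrite /lexlt !ltnn andbF. Qed.

Lemma lexlt_total p q : [|| p == q, lexlt p q | lexlt q p].
Proof.
case: p q => [a b] [c d]; rewrite /lexlt /= xpair_eqE.
by case: (ltngtP a c) => //= ac; case: (ltngtP b d).
Qed.

Lemma box_pos_inj (g : seq nat) : injective (@box_pos g).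
Proof. by move=> b b' [? ?]; apply: box_inj. Qed.

Section Numbering.
Variables (mu ka la : seq nat).

Definition precedes (r s : box ka * box mu) : bool :=
  lexlt (box_pos r.1) (box_pos s.1) || (r.1 == s.1) && lexlt (box_pos r.2) (box_pos s.2).

Lemma precedes_trans : transitive precedes.
Proof.
move=> [a b] [c d] [e f]; rewrite /precedes /= => /orP[h|/andP[/eqP-> h]] /orP[k|/andP[/eqP<- k]].
- by rewrite (lexlt_trans h k).
- by rewrite h.
- by rewrite k.
by rewrite eqxx (lexlt_trans h k) orbT.
Qed.

Lemma precedes_total r s : [|| r == s, precedes r s | precedes s r].
Proof.
case: r s => [a b] [c d]; rewrite /precedes /= xpair_eqE (eq_sym c a).
have := lexlt_total (box_pos a) (box_pos c); rewrite (inj_eq (@box_pos_inj ka)).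
have := lexlt_total (box_pos b) (box_pos d); rewrite (inj_eq (@box_pos_inj mu)).
by case/or3P=> ->; case/or3P=> ->; rewrite ?orbT //= ?orbT.
Qed.

(** Boxes with equal numbers are comparable in the reading order [precedes], and the count defining
    the index grows strictly along it. *)
Lemma numbering_inj (S : tableau ka (tableau mu nat))
    (SS : tableau ka (tableau mu (Omega la))) :
  numbering S SS -> injective (fun r : box ka * box mu => SS r.1 r.2).
Proof.
move=> num.
have index_lt r s : S r.1 r.2 = S s.1 s.2 -> precedes r s ->
    (symbol_index (SS r.1 r.2) < symbol_index (SS s.1 s.2))%N.
  move=> rs r_s; have [_ ->] := num r.1 r.2; have [_ ->] := num s.1 s.2.
  rewrite ltnS; apply/proper_card/properP; split.
    apply/subsetP=> x; rewrite !inE rs => /andP[-> /= xr].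
    exact: (precedes_trans (y := r)).
  exists r; rewrite !inE; first by rewrite rs eqxx.
  by rewrite lexlt_irr eqxx lexlt_irr andbF.
move=> r s rs; have Srs : S r.1 r.2 = S s.1 s.2.
  by have [<- _] := num r.1 r.2; have [<- _] := num s.1 s.2; rewrite rs.
case/or3P: (precedes_total r s) => [/eqP//|rs'|sr].
  by have := index_lt _ _ Srs rs'; rewrite rs ltnn.
by have := index_lt _ _ (esym Srs) sr; rewrite rs ltnn.
Qed.

End Numbering.

(** * The tableau attached to a family tuple *)

Section FamilyTableau.
Variables (m n : nat) (mu nu la : seq nat).
Hypotheses (mu_part : is_partition m mu) (nu_part : is_partition n nu).
Variables (T : family_tuple mu (kappa m nu)) (TT : tableau nu (tableau mu (Omega la))).
Hypotheses (T_family : is_family_tuple T) (T_TT : is_T_of_family T TT).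

(* Coordinates of [p] as a box of [kappa m nu], that is, transposed if m is even. *)
Definition family_row (p : box nu) : nat := if odd m then row_of p else col_of p.
Definition family_col (p : box nu) : nat := if odd m then col_of p else row_of p.

Lemma family_box_inj p p' :
  family_row p = family_row p' -> family_col p = family_col p' -> p = p'.
Proof.
by rewrite /family_row /family_col; case: ifP => _ ? ?; apply: box_inj.
Qed.

Let nu_sorted : sorted geq nu. Proof. by case/and3P: nu_part. Qed.
Let mu_sorted : sorted geq mu. Proof. by case/and3P: mu_part. Qed.

Lemma family_box p : exists p' : box (kappa m nu), box_pos p' = (family_row p, family_col p).
Proof.
suff /box_exists[p' [<- <-]] : (family_col p < nth 0%N (kappa m nu) (family_row p))%N.
  by exists p'.
rewrite /family_col /family_row /kappa; case: ifP => _; first exact: box_bound.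
by rewrite conj_partP // box_bound.
Qed.

Lemma box_of_family (p' : box (kappa m nu)) :
  exists p, box_pos p' = (family_row p, family_col p).
Proof.
rewrite /box_pos; move: (row_of p') (col_of p') (box_bound p') => i j.
rewrite /kappa /family_row /family_col.
by case: ifP => _; rewrite ?conj_partP // => /box_exists[p [<- <-]]; exists p.
Qed.

Lemma numbers_family p p' : box_pos p' = (family_row p, family_col p) ->
  numbers TT p = family_tableau T p'.
Proof.
case: T_TT => SS [num TT_SS] pp'; apply/ffunP=> q; rewrite 2!ffunE (TT_SS p p').
  by have [<- _] := num p' q.
by rewrite pp' /family_row /family_col; case: ifP.
Qed.

Lemma family_tableau_in (p' : box (kappa m nu)) :
  family_tableau T p' \in tnth T (tag p').
Proof.
rewrite ffunE -(mem_sort (@csst_le mu)) mem_nth // size_sort.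
by have [-> _] := T_family (tag p'); exact: box_bound.
Qed.

Lemma numbers_in_family p : in_family (numbers TT p) T.
Proof.
have [p' /numbers_family->] := family_box p.
by exists (tag p'); apply: family_tableau_in.
Qed.

Lemma numbers_conj_semistandard p : conj_semistandard (numbers TT p).
Proof. by have [i /(proj2 (T_family i))] := numbers_in_family p. Qed.

Lemma in_family_numbers t : in_family t T -> exists p, numbers TT p = t.
Proof.
case=> i tT; have [card_i _] := T_family i.
have [|p' [pr pc]] := @box_exists (kappa m nu) i (index t (sort (@csst_le mu) (tnth T i))).
  by rewrite -card_i -(size_sort (@csst_le mu)) index_mem mem_sort.
have [p pp'] := box_of_family p'; exists p; rewrite (numbers_family pp') ffunE.
have -> : tag p' = i by apply: val_inj.
by rewrite pc nth_index // mem_sort.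
Qed.

Lemma numbers_csst_lt p q :
  family_row p = family_row q -> (family_col p < family_col q)%N ->
  csst_lt (numbers TT p) (numbers TT q).
Proof.
move=> pq_row pq_col; have [p' pp'] := family_box p; have [q' qq'] := family_box q.
rewrite (numbers_family pp') (numbers_family qq') !ffunE.
case: pp' qq' => pr pc [qr qc].
have -> : tag p' = tag q' by apply: val_inj; rewrite -[LHS]/(row_of p') pr pq_row -qr.
have [card_i iC] := T_family (tag q').
apply: sorted_csst_lt => //; first by rewrite pc qc.
by rewrite card_i box_bound.
Qed.

Lemma family_symbols_inj :
  injective (fun pq : box nu * box mu => TT pq.1 pq.2).
Proof.
move=> [p1 q1] [p2 q2] /= e; case: T_TT => SS [num TT_SS].
have [p1' e1] := family_box p1; have [p2' e2] := family_box p2.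
have TT1 : TT p1 = SS p1' by apply: TT_SS; rewrite e1 /family_row /family_col; case: ifP.
have TT2 : TT p2 = SS p2' by apply: TT_SS; rewrite e2 /family_row /family_col; case: ifP.
rewrite TT1 TT2 in e.
have [p12 ->] := @numbering_inj _ _ _ _ _ num (p1', q1) (p2', q2) e.
congr (_, _); move: e1; rewrite p12 e2 => -[? ?]; exact: family_box_inj.
Qed.

(** There are as many pairs of boxes as symbols, so the injective map of pairs to symbols is
    onto. *)
Lemma family_calN : #|{: Omega la}| = (n * m)%N -> TT \in calN mu nu la.
Proof.
move=> card_Om; rewrite inE; apply/andP; split.
  apply/forallP=> p; apply/injectiveP=> q q' e.
  by have [] := @family_symbols_inj (p, q) (p, q') e.
apply/forallP=> w; have /codomP[[p q] ->] : w \in codom (fun pq : box nu * box mu => TT pq.1 pq.2).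
  apply: inj_card_onto family_symbols_inj _ w.
  rewrite card_Om card_prod !card_box.
  by case/and3P: mu_part => _ _ /eqP->; case/and3P: nu_part => _ _ /eqP->.
by apply/existsP; exists p; apply/existsP; exists q.
Qed.

End FamilyTableau.

(** * Signed counts of matches as linear functionals *)

Definition pairing (X : finType) (w : X -> rat) (v : freeQ X) : rat^o := \sum_x v x * w x.

Lemma pairing_is_linear (X : finType) (w : X -> rat) : linear (pairing w).
Proof.
move=> a u v; rewrite /pairing scaler_sumr -big_split /=.
by apply: eq_bigr => x _; rewrite !ffunE mulrDl -mulrA.
Qed.

HB.instance Definition _ (X : finType) (w : X -> rat) :=
  GRing.isLinear.Build rat (freeQ X) rat^o _ (pairing w) (pairing_is_linear w).

Lemma pairing_dirac (X : finType) (w : X -> rat) x : pairing w (dirac x) = w x.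
Proof.
rewrite /pairing (bigD1 x) //= big1 => [|y /negPf yx]; rewrite ffunE ?yx ?mul0r //.
by rewrite eqxx mul1r addr0.
Qed.

(* The representative is arbitrary, so [w] should be constant on tabloids. *)
Definition tabloid_weight (g : seq nat) (X : finType) (w : tableau g X -> rat)
    (Y : {set tableau g X}) : rat :=
  if [pick t in Y] is Some t then w t else 0.

Lemma tabloid_weightE (g : seq nat) (X : finType) (w : tableau g X -> rat) t :
  (forall s, s \in RPP g -> w (tmove t s) = w t) -> tabloid_weight w (tabloid t) = w t.
Proof.
move=> wt; rewrite /tabloid_weight; case: pickP => [u /imsetP[s sR ->]|/(_ t) /negP[]].
  exact: wt.
apply/imsetP; exists 1%g; first exact: group1.
by apply/ffunP=> b; rewrite ffunE invg1 perm1.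
Qed.

Section SignedMatches.
Variables (mu nu la : seq nat) (D : {group {perm box nu}}) (k : nat).
Local Notation tt := (tableau nu (tableau mu (Omega la))).
Implicit Types T U : tt.

(** The exponent [k] will be m, the size of a block. Then [sgn t ^+ k] is 1 for even m, which makes
    the count constant on tabloids, and [sgn t] for odd m, which fits the sign relation of the
    symbols |T|. *)
Definition signed_matches T U : rat :=
  \sum_(t in D) \sum_(r in ffun_on (mem (CPP mu)))
    (sgn t ^+ k * sgn_family r) *+ (star (tmove U t) r == T).

(** This equivariance and that of [signed_matches_star] make the functionals vanish on the
    relations. *)
Lemma signed_matches_move T U s : s \in D ->
  signed_matches T (tmove U s) = sgn s ^+ k * signed_matches T U.
Proof.
move=> sD; rewrite /signed_matches mulr_sumr [RHS](reindex_inj (mulgI s)) /=.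
apply: eq_big => [t|t _]; first by rewrite groupMl.
rewrite mulr_sumr; apply: eq_bigr => r _; rewrite tmove_tmove mulrnAr; congr (_ *+ _).
by rewrite sgnM exprMn !mulrA -exprMn sgn_sqr expr1n mul1r.
Qed.

Lemma sgn_family_sqr (r : {ffun box nu -> {perm box mu}}) :
  sgn_family r * sgn_family r = 1.
Proof. by rewrite -big_split big1 // => b _; apply: sgn_sqr. Qed.

Lemma signed_matches_star T U r0 : r0 \in ffun_on (mem (CPP mu)) ->
  signed_matches T (star U r0) = sgn_family r0 * signed_matches T U.
Proof.
move=> /ffun_onP r0C; rewrite /signed_matches mulr_sumr; apply: eq_bigr => t _.
(* Moving [r0] past [t] relocates its components; [shift] absorbs them into [r]. *)
pose shift (r : {ffun box nu -> {perm box mu}}) : {ffun box nu -> {perm box mu}} :=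
  [ffun p => (r0 ((t^-1)%g p) * r p)%g].
have shift_inj : injective shift.
  move=> r r' /ffunP e; apply/ffunP=> p; have := e p; rewrite !ffunE; exact: mulgI.
rewrite [in RHS](reindex_inj shift_inj) mulr_sumr /=.
have shiftC r p : (shift r p \in CPP mu) = (r p \in CPP mu).
  by rewrite ffunE groupMl //; apply: r0C.
apply: eq_big => [r|r _].
  by apply/ffun_onP/ffun_onP=> rC p; have := rC p; rewrite /= shiftC.
have -> : star (tmove (star U r0) t) r = star (tmove U t) (shift r).
  by apply/ffunP=> p; rewrite !ffunE tmove_tmove.
rewrite mulrnAr; congr (_ *+ _).
have -> : sgn_family (shift r) = sgn_family r0 * sgn_family r.
  rewrite [sgn_family r0](reindex_inj (@perm_inj _ (t^-1)%g)) -big_split /=.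
  by apply: eq_bigr => p _; rewrite ffunE sgnM.
by rewrite mulrCA (mulrA (sgn_family r0)) sgn_family_sqr mul1r.
Qed.

End SignedMatches.

Section Evaluation.
Variables (mu nu la : seq nat) (A D : {group {perm box nu}}) (k : nat).
Variable sA : {perm box nu} -> rat.
Local Notation tt := (tableau nu (tableau mu (Omega la))).
Implicit Types T U : tt.
Local Notation row_ffun := (ffun_on (mem (RPP mu))).
Local Notation col_ffun := (ffun_on (mem (CPP mu))).

(** The signed count applied to the sum that defines the homomorphism of [U]. Here [A] with weight
    [sA] is CPP(nu) with the sign for even m, and RPP(nu) with weight 1 for odd m. *)
Definition evaluation T U : rat :=
  \sum_(th in Isym la) \sum_(s in A) \sum_(x in row_ffun)
    (sgn th * sA s) *
      signed_matches D k T (star (tmove (tt_action mu nu la U th) s) x).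

Lemma signed_matches0 T U :
  (forall t r, t \in D -> r \in col_ffun -> star (tmove U t) r <> T) ->
  signed_matches D k T U = 0.
Proof.
move=> UT; rewrite /signed_matches big1 // => t tD; rewrite big1 // => r rC.
by case: eqP => // /UT; case.
Qed.

Lemma evaluation0 T U :
  (forall th s x t r, th \in Isym la -> s \in A -> x \in row_ffun -> t \in D ->
     r \in col_ffun ->
     star (tmove (star (tmove (tt_action mu nu la U th) s) x) t) r <> T) ->
  evaluation T U = 0.
Proof.
move=> UT; rewrite /evaluation; do 3![apply: big1 => ? ?].
by rewrite signed_matches0 ?mulr0 // => t r tD rC; apply: UT.
Qed.

(** The rigidity hypothesis leaves only terms with trivial [s] and [x]. In these [sgn th] cancels
    the sign of the match, so each match contributes 1, and the identity is one of them. *)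
Lemma evaluation_gt0 T : sA 1%g = 1 ->
  (forall th s x t r, th \in Isym la -> s \in A -> x \in row_ffun -> t \in D ->
     r \in col_ffun ->
     star (tmove (star (tmove (tt_action mu nu la T th) s) x) t) r = T ->
     s = 1%g /\ x = [ffun=> 1%g]) ->
  (forall th t r, star (tmove (tt_action mu nu la T th) t) r = T ->
     sgn th = sgn t ^+ k * sgn_family r) ->
  (0 < evaluation T T)%R.
Proof.
move=> sA1 rigid signs; pose e := [ffun=> 1%g] : {ffun box nu -> {perm box mu}}.
have tmove1 (g : seq nat) (X : Type) (t : tableau g X) : tmove t 1%g = t.
  by apply/ffunP=> b; rewrite ffunE invg1 perm1.
have star1 U : star U e = U by apply/ffunP=> b; rewrite !ffunE tmove1.
have term_ge0 th t r :
    0 <= sgn th * ((sgn t ^+ k * sgn_family r) *+ (star (tmove (tt_action mu nu la T th) t) r == T)).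
  case: eqP => [/signs <-|_]; last by rewrite mulr0.
  by rewrite sgn_sqr.
have evalE : evaluation T T =
    \sum_(th in Isym la) sgn th * signed_matches D k T (tt_action mu nu la T th).
  apply: eq_bigr => th thI; rewrite (bigD1 1%g) ?group1 //= (bigD1 e) /=; last first.
    by apply/ffun_onP=> p; rewrite ffunE; exact: group1.
  rewrite tmove1 star1 sA1 mulr1 big1 ?addr0 => [|x /andP[xR /eqP xe]]; last first.
    rewrite signed_matches0 ?mulr0 // => t r tD rC UT; apply: xe.
    by have [] := rigid th 1%g x t r thI (group1 _) xR tD rC; rewrite ?tmove1.
  rewrite big1 ?addr0 // => s /andP[sAs /eqP s1]; apply: big1 => x xR.
  rewrite signed_matches0 ?mulr0 // => t r tD rC UT; apply: s1.
  by have [] := rigid th s x t r thI sAs xR tD rC UT.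
have signed_ge0 th : 0 <= sgn th * signed_matches D k T (tt_action mu nu la T th).
  rewrite mulr_sumr sumr_ge0 // => t _; rewrite mulr_sumr sumr_ge0 // => r _; exact: term_ge0.
have one_I : 1%g \in Isym la by rewrite inE; apply/forallP=> w; rewrite perm1.
rewrite evalE (bigD1 1%g) //= ltr_wpDr ?sumr_ge0 //.
rewrite mulr_sumr (bigD1 1%g) ?group1 //= ltr_wpDr ?sumr_ge0 // => [t _|].
  by rewrite mulr_sumr sumr_ge0.
rewrite mulr_sumr (bigD1 e) /=; last by apply/ffun_onP=> p; rewrite ffunE; exact: group1.
rewrite ltr_wpDr ?sumr_ge0 //.
rewrite act1 tmove1 star1 eqxx !sgn1 expr1n !mul1r mulr1n /sgn_family big1 // => p _.
by rewrite ffunE sgn1.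
Qed.

End Evaluation.

(** * Linear independence from triangular functionals *)

Lemma coset_mod_sum (gT : finGroupType) (M : gmodule gT) (I : finType) (c : I -> rat)
    (v : I -> freeQ (gm_base M)) :
  coset_mod (M := M) (\sum_i c i *: v i) = \sum_i c i *: coset_mod (M := M) (v i).
Proof.
rewrite /coset_mod !linear_sum; apply: eq_bigr => i _; by rewrite !linearZ.
Qed.

(** A vanishing combination of the maps, evaluated at [x], puts the same combination of the [v e]
    into the relations. For the largest [e] with nonzero coefficient, [L e] kills every other
    term. *)
Lemma free_of_triangular_functionals (gT : finGroupType) (Q : gmodule gT)
    (V H : vectType rat) (iota : 'Hom(H, carrier Q)) (x : V) (d : nat)
    (F : 'I_d -> 'Hom(V, H)) (v : 'I_d -> freeQ (gm_base Q))
    (L : 'I_d -> {linear freeQ (gm_base Q) -> rat^o}) :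
  (forall e, v e \in gm_sub Q) ->
  (forall e, iota (F e x) = coset_mod (M := Q) (v e)) ->
  (forall e u, u \in gm_rel Q -> L e u = 0) ->
  (forall c e : 'I_d, (c < e)%N -> L e (v c) = 0) ->
  (forall e, L e (v e) != 0) ->
  free [seq F e | e <- enum 'I_d].
Proof.
move=> v_sub iotaF L_rel L_lt L_ne.
have -> : [seq F e | e <- enum 'I_d] = map_tuple F (ord_tuple d) by [].
apply/freeP=> c; have nthF (e : 'I_d) : (map_tuple F (ord_tuple d))`_e = F e.
  by rewrite -tnth_nth tnth_map tnth_ord_tuple.
under eq_bigr do rewrite nthF.
move=> sumF; have rel : \sum_e c e *: v e \in gm_rel Q.
  rewrite -coset_mod_eq0 ?memv_suml // => [|e _]; last by rewrite memvZ.
  have /(congr1 iota) : (\sum_e c e *: F e) x = 0 by rewrite sumF zero_lfunE.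
  rewrite sum_lfunE linear0 linear_sum coset_mod_sum => sum0; apply/eqP.
  rewrite -[RHS]sum0; apply: eq_bigr => e _; by rewrite scale_lfunE linearZ /= iotaF.
move=> e0; apply/eqP/negbNE/negP=> ce0.
have [e /= ce e_max] := @max_difference _ (fun e => c e != 0) _ ce0.
have := L_rel e _ rel; rewrite linear_sum (bigD1 e) //= big1 ?addr0 => [|i ie]; last first.
  rewrite linearZ /=; have [ei|ie'|ee] := ltngtP i e.
  - by rewrite L_lt // scaler0.
  - by have /negbNE/eqP-> := e_max _ ie'; rewrite scale0r.
  by rewrite (val_inj ee) eqxx in ie.
by move/eqP; rewrite linearZ /= scaler_eq0 (negPf ce) (negPf (L_ne e)).
Qed.

Lemma pairing_relation (X : finType) (w : X -> rat) (a : rat) x y :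
  w x = a * w y -> pairing w (dirac x - a *: dirac y) = 0.
Proof. by move=> wxy; rewrite linearB linearZ /= !pairing_dirac wxy; apply: subrr. Qed.

(** Membership in the zero space is the form in which [memv_sum_line_map] passes from generators to
    sums of lines. *)
Lemma pairing_line (X : finType) (w : X -> rat) (u v : freeQ X) :
  pairing w u = 0 -> v \in <[u]>%VS -> pairing w v \in (0%VS : {vspace rat^o}).
Proof. by move=> wu; apply: memv_line_map wu (mem0v _). Qed.

Lemma pairing_C_space (mu nu la : seq nat)
    (w : {set tableau nu (tableau mu (Omega la))} -> rat) u :
  (forall U r, r \in ffun_on (mem (CPP mu)) ->
     w (tabloid (star U r)) = sgn_family r * w (tabloid U)) ->
  u \in C_space mu nu la -> pairing w u = 0.
Proof.
move=> w_star uC; apply/eqP; rewrite -memv0.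
apply: memv_sum_line_map uC => U y _; apply: memv_sum_line_map => r z rC.
by apply: pairing_line; apply: pairing_relation; apply: w_star.
Qed.

Lemma pairing_Ct_space (mu nu la : seq nat)
    (w : tableau nu (tableau mu (Omega la)) -> rat) u :
  (forall U s, s \in CPP nu -> w (tmove U s) = sgn s * w U) ->
  (forall U r, r \in ffun_on (mem (CPP mu)) -> w (star U r) = sgn_family r * w U) ->
  u \in Ct_space mu nu la -> pairing w u = 0.
Proof.
move=> w_move w_star /memv_addP[u1 u1C [u2 u2C ->]].
apply/eqP; rewrite -memv0 linearD; apply: memvD.
  apply: memv_sum_line_map u1C => U y _; apply: memv_sum_line_map => s z sC.
  by apply: pairing_line; apply: pairing_relation; apply: w_move.
apply: memv_sum_line_map u2C => U y _; apply: memv_sum_line_map => r z rC.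
by apply: pairing_line; apply: pairing_relation; apply: w_star.
Qed.

(** * Triangularity of the evaluations, for both parities at once *)

(** A match for [c < e] would put the distinguished tableau of [T e] below a tableau of [T c] in the
    column order, against its maximality. On the diagonal, [match_self] gives rigidity and
    [sgn_match] the signs. *)
Lemma family_evaluation (m n : nat) (mu nu la : seq nat)
    (mu_part : is_partition m mu) (nu_part : is_partition n nu)
    (card_la : #|{: Omega la}| = (n * m)%N)
    (d : nat) (T : 'I_d -> family_tuple mu (kappa m nu))
    (T_family : forall e, is_family_tuple (T e))
    (T_max : forall e, exists s : tableau mu nat,
       [/\ conj_semistandard s, in_family s (T e)
         & forall (c : 'I_d) (u : tableau mu nat),
             (c < e)%N -> in_family u (T c) -> col_lt u s])
    (TT : 'I_d -> tableau nu (tableau mu (Omega la)))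
    (T_TT : forall e, is_T_of_family (T e) (TT e))
    (A D : {group {perm box nu}}) (sA : {perm box nu} -> rat) :
  (forall s b, s \in A -> family_row m (s b) = family_row m b) ->
  (forall t b, t \in D -> family_col m (t b) = family_col m b) ->
  sA 1%g = 1 ->
  (forall c e : 'I_d, (c < e)%N -> evaluation A D m sA (TT e) (TT c) = 0) /\
  (forall e, 0 < evaluation A D m sA (TT e) (TT e)).
Proof.
move=> A_row D_col sA1.
have numC e p := numbers_conj_semistandard nu_part (T_family e) (T_TT e) p.
split=> [c e ce|e].
  apply: evaluation0 => th s x t r thI sAs xR tD rC match_ec.
  have [u [_ /(in_family_numbers nu_part (T_family e) (T_TT e))[p <-] u_max]] := T_max e.
  have [p' le_ec] := col_le_match thI xR rC (numC c) match_ec p.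
  have [_] := u_max c _ ce (numbers_in_family nu_part (T_family c) (T_TT c) p').
  by case.
apply: evaluation_gt0 => // [th s x t r thI sAs xR tD rC|th t r].
  apply: (match_self (a := @family_row m nu) (d := @family_col m nu)) => //.
  - by move=> b; apply: A_row.
  - by move=> b; apply: D_col.
  - exact: family_box_inj.
  exact: (numbers_csst_lt mu_part nu_part (T_family e) (T_TT e)).
have <- : #|{: box mu}| = m by rewrite card_box; case/and3P: mu_part => _ _ /eqP.
apply: sgn_match; first exact: (family_calN mu_part nu_part (T_TT e)).
exact: (family_symbols_inj nu_part (T_TT e)).
Qed.

(** * Linear independence in the even and the odd case *)

Theorem proposition8p1 (m n : nat) (mu nu la : seq nat)
    (mu_part : is_partition m mu) (nu_part : is_partition n nu)
    (la_min : minimal_type (m * n) mu (kappa m nu) la)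
    (d : nat) (T : 'I_d -> family_tuple mu (kappa m nu))
    (T_family : forall e, is_family_tuple (T e))
    (T_type : forall e, has_type la (T e))
    (T_max : forall e, exists s : tableau mu nat,
       [/\ conj_semistandard s, in_family s (T e)
         & forall (c : 'I_d) (u : tableau mu nat),
             (c < e)%N -> in_family u (T c) -> col_lt u s])
    (beta : 'I_n * 'I_m -> Omega la) (beta_bij : bijective beta) :
  (~~ odd m ->
    forall (iota : 'Hom(carrier (foulkes mu nu beta), carrier (N_mod_C mu nu la)))
      (f : 'I_d -> 'Hom(carrier (M_tilde la (Omega la)), carrier (N_mod_C mu nu la)))
      (F : 'I_d -> 'Hom(carrier (specht la (Omega la)), carrier (foulkes mu nu beta))),
    identifies iota ->
    (forall e, is_fbar (T e) (f e)) ->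
    (forall e, is_induced iota (f e) (F e)) ->
    free [seq F e | e <- enum 'I_d])
  /\
  (odd m ->
    forall (iota : 'Hom(carrier (foulkes mu nu beta), carrier (Nt_mod_Ct mu nu la)))
      (g : 'I_d -> 'Hom(carrier (M_tilde la (Omega la)), carrier (Nt_mod_Ct mu nu la)))
      (G : 'I_d -> 'Hom(carrier (specht la (Omega la)), carrier (foulkes mu nu beta))),
    identifies iota ->
    (forall e, is_gbar (T e) (g e)) ->
    (forall e, is_induced iota (g e) (G e)) ->
    free [seq G e | e <- enum 'I_d]).
Proof.
have card_la : #|{: Omega la}| = (n * m)%N.
  by rewrite -(bij_eq_card beta_bij) card_prod !card_ord.
have t_la_inj : injective (t_la la) by move=> b b'; rewrite !ffunE.
split=> [m_even iota f F _ f_bar f_F|m_odd iota g G _ g_bar g_G].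
  have f_val e : exists TT, is_T_of_family (T e) TT /\ _ :=
    let: conj _ (ex_intro2 TT T_TT fE) := f_bar e in ex_intro _ TT (conj T_TT fE).
  have [TT {f_val}f_val] := fin_all_exists f_val.
  have [||//|eval_lt eval_gt] := family_evaluation mu_part nu_part card_la T_family T_max
    (fun e => proj1 (f_val e)) (A := CPP_group nu) (D := RPP_group nu) (sA := @sgn _).
  - by move=> s b sC; rewrite /family_row (negPf m_even) CPP_col.
  - by move=> t b tR; rewrite /family_col (negPf m_even) RPP_row.
  - exact: sgn1.
  (* For even m the count is invariant under RPP(nu), so it descends to tabloids. *)
  have sgn_even (s : {perm box nu}) : sgn s ^+ m = 1.
    by rewrite /sgn exprAC -(signr_odd _ m) (negPf m_even) expr0 expr1n.
  pose w e := tabloid_weight (signed_matches (RPP_group nu) m (TT e)).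
  have wE e U : w e (tabloid U) = signed_matches (RPP_group nu) m (TT e) U.
    by apply: tabloid_weightE => s sR; rewrite signed_matches_move // sgn_even mul1r.
  pose v e := \sum_(th in Isym la) \sum_(s in CPP nu) \sum_(r in ffun_on (mem (RPP mu)))
    (sgn th * sgn s) *:
      dirac (tabloid (star (tmove (tt_action mu nu la (TT e) th) s) r)).
  have pairE e c :
      pairing (w e) (v c) = evaluation (CPP_group nu) (RPP_group nu) m (@sgn _) (TT e) (TT c).
    rewrite linear_sum; apply: eq_bigr => th _; rewrite linear_sum; apply: eq_bigr => s _.
    rewrite linear_sum; apply: eq_bigr => r _.
    by rewrite linearZ /= pairing_dirac wE.
  (* The test vector [x] is e(t_la), the image of |t_la|, where the value of every induced map is
     prescribed. *)
  apply: (free_of_triangular_functionals (Q := N_mod_C mu nu la) (iota := iota)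
            (x := coset_mod (M := specht la (Omega la)) (polytabloid (t_la la)))
            (v := v) (L := fun e => pairing (w e))) => /=.
  - move=> e; rewrite /v; do 3![apply: memv_suml => ? ?]; rewrite memvZ // mem_N //.
    apply/calN_star/calN_move/calN_act.
    exact: (family_calN mu_part nu_part (proj1 (f_val e))).
  - by move=> e; rewrite (proj2 (f_F e)) // (proj2 (f_val e)).
  - move=> e u uC; apply: pairing_C_space uC => U r rC.
    by rewrite !wE signed_matches_star.
  - by move=> c e ce; rewrite pairE eval_lt.
  by move=> e; rewrite pairE lt0r_neq0.
have g_val e : exists TT, is_T_of_family (T e) TT /\ _ :=
  let: conj _ (ex_intro2 TT T_TT gE) := g_bar e in ex_intro _ TT (conj T_TT gE).
have [TT {g_val}g_val] := fin_all_exists g_val.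
have [||//|eval_lt eval_gt] := family_evaluation mu_part nu_part card_la T_family T_max
  (fun e => proj1 (g_val e)) (A := RPP_group nu) (D := CPP_group nu) (sA := fun=> 1).
- by move=> s b sR; rewrite /family_row m_odd RPP_row.
- by move=> t b tC; rewrite /family_col m_odd CPP_col.
(* For odd m the count changes by [sgn s] under CPP(nu), as the first summand of [Ct_space]
   demands. *)
have sgn_odd (s : {perm box nu}) : sgn s ^+ m = sgn s.
  by rewrite /sgn exprAC -(signr_odd _ m) m_odd expr1.
pose w e := signed_matches (CPP_group nu) m (TT e).
pose v e := \sum_(th in Isym la) \sum_(s in RPP nu) \sum_(r in ffun_on (mem (RPP mu)))
  sgn th *: dirac (star (tmove (tt_action mu nu la (TT e) th) s) r).
have pairE e c :
    pairing (w e) (v c) = evaluation (RPP_group nu) (CPP_group nu) m (fun=> 1) (TT e) (TT c).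
  rewrite linear_sum; apply: eq_bigr => th _; rewrite linear_sum; apply: eq_bigr => s _.
  rewrite linear_sum; apply: eq_bigr => r _.
  by rewrite linearZ /= pairing_dirac mulr1.
apply: (free_of_triangular_functionals (Q := Nt_mod_Ct mu nu la) (iota := iota)
          (x := coset_mod (M := specht la (Omega la)) (polytabloid (t_la la)))
          (v := v) (L := fun e => pairing (w e))) => /=.
- move=> e; rewrite /v; do 3![apply: memv_suml => ? ?]; rewrite memvZ // mem_Nt //.
  apply/calN_star/calN_move/calN_act.
  exact: (family_calN mu_part nu_part (proj1 (g_val e))).
- by move=> e; rewrite (proj2 (g_G e)) // (proj2 (g_val e)).
- move=> e u uC; apply: pairing_Ct_space uC => [U s sC|U r rC].
    by rewrite /w signed_matches_move // sgn_odd.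
  exact: signed_matches_star.
- by move=> c e ce; rewrite pairE eval_lt.
by move=> e; rewrite pairE lt0r_neq0.
Qed.
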